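(* Let $\mathbb{K}$ be a field, $S=\mathbb{K}[x_1,\dots,x_n]$, and let $I_1,I_2\subseteq S$ be strongly stable ideals, each having exactly two Borel generators, both of degree two. Then the multi-Rees algebra $\mathcal{R}(I_1\oplus I_2)$ is Koszul. In particular, products of powers of $I_1$ and $I_2$ have linear resolutions; that is, $I_1^{a_1}I_2^{a_2}$ has a linear resolution over $S$ for all $a_1,a_2\ge0$.
   Context: A monomial ideal $I\subseteq S$ is strongly stable if for each monomial $m\in I$ one has $x_j\frac{m}{x_i}\in I$ whenever $x_i$ divides $m$ and $j<i$. For monomials $m_1,\dots,m_k$ of the same degree, $\mathcal{B}(m_1,\dots,m_k)$ is the smallest strongly stable ideal containing them; if $I=\mathcal{B}(m_1,\dots,m_k)$, there is a unique minimal such set of monomials, whose elements are the Borel generators of $I$. The multi-Rees algebra is $\mathcal{R}(I_1\oplus I_2)=\bigoplus_{a_1,a_2\ge0}I_1^{a_1}I_2^{a_2}t_1^{a_1}t_2^{a_2}\subseteq S[t_1,t_2]$, regarded as a standard graded $\mathbb{K}$-algebra generated in degree one by $x_1,\dots,x_n$ and the elements $ut_i$ with $u$ a minimal monomial generator of $I_i$, $i=1,2$. A standard graded $\mathbb{K}$-algebra $A$ is Koszul if $A/A_+\cong\mathbb{K}$ has a linear resolution over $A$. *)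

(* Defs.v *)
From HB Require Import structures.
From mathcomp Require Import all_boot all_order all_algebra.
From mathcomp Require Import ring_quotient boolp classical_sets.
From mathcomp Require Import mpoly.

Set Implicit Arguments.
Unset Strict Implicit.
Unset Printing Implicit Defensive.

Import GRing.Theory.
Local Open Scope ring_scope.

Record submodule (R : nzRingType) (V : lmodType R) := Submodule {
  submodule_pred :> {pred V};
  submodule_closed : submod_closed submodule_pred
}.

HB.instance Definition _ (R : nzRingType) (V : lmodType R) (N : submodule V) :=
  GRing.isSubmodClosed.Build R V (submodule_pred N) (submodule_closed N).

(* Ideals are the submodules of the regular module. *)
Notation ideal R := (submodule (R^o)).

Section SubmoduleAsModule.
Variables (R : nzRingType) (V : lmodType R) (N : submodule V).

Record submod := Submod { submod_val : V; submod_valP : submod_val \in N }.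
HB.instance Definition _ := [isSub for submod_val].
HB.instance Definition _ := [Choice of submod by <:].
HB.instance Definition _ := [SubChoice_isSubLmodule of submod by <:].

End SubmoduleAsModule.

Section QuotientModule.
Variables (R : nzRingType) (V : lmodType R) (N : submodule V).
Local Open Scope quotient_scope.

Definition quotmod := Quotient.quot (submodule_pred N).
HB.instance Definition _ := GRing.Zmodule.on quotmod.
HB.instance Definition _ := EqQuotient.on quotmod.

Definition qscale (a : R) (x : quotmod) : quotmod := \pi_quotmod (a *: repr x).

Lemma quotmod_eqE (x y : V) : (\pi_quotmod x == \pi_quotmod y) = (x - y \in N).
Proof. by rewrite (Quotient.idealrBE N). Qed.

Lemma qscale_pi a (x : V) : qscale a (\pi_quotmod x) = \pi_quotmod (a *: x).
Proof.
apply/eqP; rewrite quotmod_eqE -scalerBr rpredZ // -quotmod_eqE.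
by rewrite reprK.
Qed.

Lemma quotmod_addE (x y : V) : \pi_quotmod (x + y) = \pi_quotmod x + \pi_quotmod y.
Proof. exact: (raddfD \pi_(Quotient.quot (submodule_pred N))). Qed.

Fact qscaleA a b x : qscale a (qscale b x) = qscale (a * b) x.
Proof. by rewrite -[x]reprK [qscale b _]qscale_pi !qscale_pi scalerA. Qed.

Fact qscale1 : left_id 1 qscale.
Proof. by move=> x; rewrite -[x]reprK qscale_pi scale1r. Qed.

Fact qscaleDr : right_distributive qscale +%R.
Proof.
move=> a x y; rewrite -[x]reprK -[y]reprK -quotmod_addE !qscale_pi.
by rewrite scalerDr quotmod_addE.
Qed.

Fact qscaleDl x : {morph qscale^~ x : a b / a + b}.
Proof.
by move=> a b; rewrite -[x]reprK !qscale_pi scalerDl quotmod_addE.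
Qed.

HB.instance Definition _ :=
  GRing.Zmodule_isLmodule.Build R quotmod qscaleA qscale1 qscaleDr qscaleDl.

End QuotientModule.

Section IdealOperations.
Variable R : comNzRingType.
Implicit Types (I J : ideal R) (X : set R).

Definition ideal_span_pred X (f : R) : bool :=
  `[< exists k (r x : 'I_k -> R),
        (forall i, X (x i)) /\ f = \sum_i r i * x i >].

Fact ideal_span_pred_closed X : submod_closed (ideal_span_pred X : {pred R^o}).
Proof.
split; first by apply/asboolP; exists 0, (fun=> 0), (fun=> 0); split; [case | rewrite big_ord0].
move=> a u v /asboolP [k [r [x [Hx ->]]]] /asboolP [l [s [y [Hy ->]]]].
apply/asboolP; exists (k + l)%N.
exists (fun i => match split i with inl j => a * r j | inr j => s j end).
exists (fun i => match split i with inl j => x j | inr j => y j end).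
split; first by move=> i; case: (split i).
rewrite big_split_ord /= [a *: _]mulr_sumr; congr (_ + _); apply: eq_bigr => i _.
  by rewrite (unsplitK (inl i)) mulrA.
by rewrite (unsplitK (inr i)).
Qed.

Definition ideal_gen X : ideal R := Submodule (ideal_span_pred_closed X).

Definition ideal_mul I J : ideal R :=
  ideal_gen [set f | exists x y : R, [/\ x \in I, y \in J & f = x * y]].

Fixpoint ideal_exp I (a : nat) : ideal R :=
  if a is b.+1 then ideal_mul I (ideal_exp I b) else ideal_gen [set 1].

Lemma mem_ideal_gen X x : X x -> x \in ideal_gen X.
Proof.
move=> Xx; apply/asboolP; exists 1%N, (fun=> 1), (fun=> x).
by rewrite big_ord1 mul1r.
Qed.

Lemma idealMl I (a x : R) : x \in I -> a * x \in I.
Proof. exact: rpredZ. Qed.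

Lemma ideal0 I : (0 : R) \in I.
Proof. exact: rpred0. Qed.

Lemma idealB I (x y : R) : x \in I -> y \in I -> x - y \in I.
Proof. exact: rpredB. Qed.

Lemma ideal_sum I (T : Type) (r : seq T) (P : pred T) (F : T -> R) :
  (forall i, P i -> F i \in I) -> \sum_(i <- r | P i) F i \in I.
Proof. exact: (rpred_sum (S := I)). Qed.

Lemma ideal_genMr X I f y :
  (forall x, X x -> x * y \in I) -> f \in ideal_gen X -> f * y \in I.
Proof.
move=> XI /asboolP [k [r [x [Hx ->]]]]; rewrite mulr_suml.
by apply: ideal_sum => i _; rewrite -mulrA; apply/idealMl/XI.
Qed.

Lemma mem_ideal_mul I J x y : x \in I -> y \in J -> x * y \in ideal_mul I J.
Proof. by move=> xI yJ; apply: mem_ideal_gen; exists x, y. Qed.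

Lemma mem_ideal_exp0 I x : x \in ideal_exp I 0.
Proof. by rewrite -[x]mulr1; apply/idealMl/mem_ideal_gen. Qed.

Lemma mem_ideal_expD I a b x y :
  x \in ideal_exp I a -> y \in ideal_exp I b -> x * y \in ideal_exp I (a + b).
Proof.
elim: a x => [|a IHa] x xI yI; first exact: idealMl.
apply: ideal_genMr xI => _ [u [v [uI vI ->]]].
by rewrite -mulrA; apply: mem_ideal_mul => //; apply: IHa.
Qed.

Lemma mem_ideal_mul_expD I J a b c d x y :
  x \in ideal_mul (ideal_exp I a) (ideal_exp J b) ->
  y \in ideal_mul (ideal_exp I c) (ideal_exp J d) ->
  x * y \in ideal_mul (ideal_exp I (a + c)) (ideal_exp J (b + d)).
Proof.
move=> xM yM; apply: ideal_genMr xM => _ [u [v [uI vJ ->]]].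
rewrite mulrC; apply: ideal_genMr yM => _ [u' [v' [uI' vJ' ->]]].
rewrite mulrC mulrACA.
by apply: mem_ideal_mul; apply: mem_ideal_expD.
Qed.

End IdealOperations.

Section Resolutions.
Variables (A : comNzRingType) (grA : nat -> set A).

(* A graded free resolution
     ... -> A(-q-2)^(b 2) -> A(-q-1)^(b 1) -> A(-q)^(b 0) -> M -> 0 :
   degree-preserving maps A(-d-1)^m -> A(-d)^k are exactly the matrices with
   entries in A_1 (acting on row vectors), and degree-preserving maps
   A(-q)^k -> M are given by k elements of M_q. *)
Definition has_linear_resolution (M : lmodType A) (grM : nat -> set M) : Prop :=
  exists (q : nat) (b : nat -> nat) (e : 'I_(b 0) -> M)
         (D : forall i, 'M[A]_(b i.+1, b i)),
  let aug (v : 'rV[A]_(b 0)) : M := \sum_j v 0 j *: e j in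
  [/\ forall j, grM q (e j),
      forall i j k, grA 1 (D i j k),
      forall x : M, exists v, aug v = x,
      forall v, aug v = 0 <-> exists w, v = w *m D 0
    & forall i (v : 'rV[A]_(b i.+1)), v *m D i = 0 <-> exists w, v = w *m D i.+1].

(* The ideal A_+ of a nonnegatively graded ring. *)
Definition irrelevant_ideal : ideal A := 
  ideal_gen [set a | exists2 d, (0 < d)%N & grA d a].

Definition residue_module : lmodType A := quotmod irrelevant_ideal.

Definition residue_gr (d : nat) : set residue_module :=
  [set x | exists2 a : A, grA d a & x = (\pi_(quotmod irrelevant_ideal) a)%qT].

End Resolutions.

Arguments residue_gr {A} grA d.

Section StandardGraded.
Variables (K : fieldType) (A : comAlgType K) (gr : nat -> set A).

Record standard_graded : Prop := StandardGraded {
  gr0_in : forall d, gr d 0;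
  gr_lin : forall d (c : K) x y, gr d x -> gr d y -> gr d (c *: x + y);
  gr_mul : forall d e x y, gr d x -> gr e y -> gr (d + e) (x * y);
  gr_decomp : forall x, exists N (s : nat -> A),
    (forall d, gr d (s d)) /\ x = \sum_(d < N) s d;
  gr_direct : forall N (s : nat -> A), (forall d, gr d (s d)) ->
    \sum_(d < N) s d = 0 -> forall d, (d < N)%N -> s d = 0;
  gr_0E : forall x, gr 0 x <-> exists c : K, x = c *: 1;
  gr_1fin : exists k (x : 'I_k -> A), (forall i, gr 1 (x i)) /\
    forall y, gr 1 y -> exists c : 'I_k -> K, y = \sum_i c i *: x i;
  gr_gen : forall d x, gr d.+1 x -> exists k (y z : 'I_k -> A),
    (forall i, gr 1 (y i) /\ gr d (z i)) /\ x = \sum_i y i * z i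
}.

Definition Koszul : Prop :=
  standard_graded /\ has_linear_resolution gr (residue_gr gr).

End StandardGraded.

Section MonomialIdeals.
Variables (K : fieldType) (n : nat).
Local Notation S := {mpoly K[n]}.
Implicit Types (I J : ideal S) (m u v : 'X_{1..n}) (G : seq 'X_{1..n}).

Definition monomial_ideal I : Prop :=
  exists X : set 'X_{1..n}, I =i ideal_gen [set 'X_[m] | m in X].

(* x_j m / x_i; the truncated subtraction is exact because x_i divides m. *)
Definition strongly_stable I : Prop :=
  monomial_ideal I /\
  forall m (i j : 'I_n), 'X_[m] \in I -> (0 < m i)%N -> (j < i)%N ->
    'X_[m - U_(i) + U_(j)] \in I.

Definition is_borel_ideal G I : Prop :=
  [/\ strongly_stable I, forall m, m \in G -> 'X_[m] \in I
    & forall J, strongly_stable J -> (forall m, m \in G -> 'X_[m] \in J) ->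
        {subset I <= J}].

(* A set of monomials is represented by a duplicate-free sequence. *)
Definition borel_generators G I : Prop :=
  [/\ uniq G, is_borel_ideal G I
    & forall G', {subset G' <= G} -> is_borel_ideal G' I -> {subset G <= G'}].

Definition minimal_monomial_generator I u : Prop :=
  'X_[u] \in I /\ forall v, 'X_[v] \in I -> (v <= u)%MM -> v = u.

Definition poly_gr (d : nat) : set S := [set p | p \is d.-homog].

Definition ideal_gr I (d : nat) : set (submod I) :=
  [set f | poly_gr d (submod_val (f : submod I))].

End MonomialIdeals.

Section MultiRees.
Variables (K : fieldType) (n : nat) (I1 I2 : ideal {mpoly K[n]}).
Local Notation S := {mpoly K[n]}.

(* Variables 0 and 1 of {mpoly S[2]} are t_1 and t_2. *)
Definition rees_pred (f : {mpoly S[2]}) : bool :=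
  `[< forall a : 'X_{1..2},
        f@_a \in ideal_mul (ideal_exp I1 (a 0)) (ideal_exp I2 (a 1)) >].

Fact rees_polyC c : rees_pred c%:MP.
Proof.
apply/asboolP => a; rewrite mcoeffC; case: eqVneq => [->|_].
  rewrite !mnm0E mulr1 -[c]mulr1.
  by apply: mem_ideal_mul; apply: mem_ideal_exp0.
by rewrite mulr0; apply: ideal0.
Qed.

Fact rees_subring : subring_closed rees_pred.
Proof.
split=> [|f g /asboolP fR /asboolP gR|f g /asboolP fR /asboolP gR].
- exact: rees_polyC.
- by apply/asboolP => a; rewrite mcoeffB; apply: idealB.
apply/asboolP => a; rewrite mcoeffM; apply: ideal_sum => k /eqP Ek.
by rewrite [in ideal_exp I1 _]Ek [in ideal_exp I2 _]Ek !mnmDE; apply: mem_ideal_mul_expD.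
Qed.

HB.instance Definition _ :=
  GRing.isSubringClosed.Build {mpoly S[2]} rees_pred rees_subring.

Record rees := Rees { rees_val : {mpoly S[2]}; rees_valP : rees_val \in rees_pred }.
HB.instance Definition _ := [isSub for rees_val].
HB.instance Definition _ := [Choice of rees by <:].
HB.instance Definition _ := [SubChoice_isSubComNzRing of rees by <:].

Definition rees_scale (c : K) (f : rees) : rees := Rees (rees_polyC c%:MP) * f.

Fact rees_scaleA a b f : rees_scale a (rees_scale b f) = rees_scale (a * b) f.
Proof. by apply: val_inj; rewrite /= !mpolyCM mulrA. Qed.

Fact rees_scale1 : left_id 1 rees_scale.
Proof. by move=> f; apply: val_inj; rewrite /= mul1r. Qed.

Fact rees_scaleDr : right_distributive rees_scale +%R.
Proof. by move=> a f g; rewrite /rees_scale mulrDr. Qed.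

Fact rees_scaleDl f : {morph rees_scale^~ f : a b / a + b}.
Proof. by move=> a b; apply: val_inj; rewrite /= !mpolyCD mulrDl. Qed.

HB.instance Definition _ := GRing.Zmodule_isLmodule.Build K rees
  rees_scaleA rees_scale1 rees_scaleDr rees_scaleDl.

Fact rees_scaleAl a (f g : rees) : a *: (f * g) = (a *: f) * g.
Proof. exact: mulrA. Qed.

HB.instance Definition _ := GRing.Lmodule_isLalgebra.Build K rees rees_scaleAl.
HB.instance Definition _ := GRing.Lalgebra_isComAlgebra.Build K rees.

Definition rees_generator : set rees :=
  [set f | [\/ exists i : 'I_n, rees_val f = ('X_i)%:MP,
      exists2 u, minimal_monomial_generator I1 u
                 & rees_val f = 'X_[u] *: 'X_0
    | exists2 u, minimal_monomial_generator I2 u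
                 & rees_val f = 'X_[u] *: 'X_1]].

(* Degree d: the K-span of the d-fold products of generators. *)
Definition rees_gr (d : nat) : set rees :=
  [set f | exists k (c : 'I_k -> K) (g : 'I_k -> 'I_d -> rees),
     (forall i j, rees_generator (g i j)) /\
     f = \sum_i c i *: \prod_j g i j].

End MultiRees.

(* Main.v *)
(* The multi-Rees algebra has the K-basis [x^p t1^i t2^j] with [x^p] in
   [I1^i I2^j], and is generated by "letters", the variables [x_l] and the
   elements [x_k x_l t_s].  Give the letters weights and call a word of letters
   standard when each pair of its letters has least weight among the pairs with
   the same product.  If a standard word is determined by its product, then the
   algebra degenerates to a quadratic monomial algebra, and the resolution of K
   over the latter lifts, by induction on weights, to a linear resolution over
   the former: a basis element [e_j] of one free module gives rise, for each
   letter [y_i] in a set attached to [j], to a basis element of the next one,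
   mapped to [y_i e_j] plus terms of smaller weight.

   For two Borel generators of degree two, the pairs [k <= l] with [x_k x_l] in
   the ideal form a staircase: [k <= a, l <= b] or [k <= c, l <= d].  A word
   distributes a multiset of indices over slots of bounded capacity (low and high
   slots of letters of the corner [d < l <= b], of the other letters, and of the
   variables).  The weights favour, in this order: few corner letters for one
   ideal, few corner letters for the other, small indices in a fixed order of
   priority among the kinds of slots, and low and high indices sorted alike.
   Comparing the number of indices with the number of slots of capacity at most
   [k], for suitable [k], shows that the numbers of corner letters of a standard
   word are least possible; the rest is then forced.

   Over S itself the same resolution gives the linear resolution of an ideal that
   is stable under Borel moves and generated in one degree, such as
   [I1^a1 I2^a2]. *)

Require Import Defs.
From mathcomp Require Import all_boot all_order all_algebra.
From mathcomp Require Import mpoly.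
From mathcomp Require Import ring_quotient boolp classical_sets.
From mathcomp Require Import zify.

Set Implicit Arguments.
Unset Strict Implicit.
Unset Printing Implicit Defensive.

Import GRing.Theory.
Local Open Scope ring_scope.

(** * Linear resolutions from quadratic standard bases *)

Lemma mnm_neq0_exists (n : nat) (w : 'X_{1..n}) : w != 0%MM -> exists i, w i != 0%N.
Proof.
move=> nz; apply/existsP; apply: contraNT nz; rewrite negb_exists => /forallP H.
by apply/eqP/mnmP => i; rewrite mnm0E; apply/eqP; have := H i; rewrite negbK.
Qed.

Section QuadraticStandardBasis.

Variables (K : fieldType) (A : comAlgType K) (N : nat).
Variables (y : 'I_N -> A) (om : 'I_N -> nat) (good : rel 'I_N).
Variable cf : A -> 'X_{1..N} -> K.

Definition word_mon (w : 'X_{1..N}) : A := \prod_i y i ^+ w i.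
Definition word_wt (w : 'X_{1..N}) : nat := (\sum_i w i * om i)%N.
(** Taking [i = j] covers squares: a letter must be good with itself only if it occurs at least
    twice in [w]. *)
Definition word_std (w : 'X_{1..N}) : bool :=
  [forall i, forall j, (U_(i) + U_(j) <= w)%MM ==> good i j].

Local Notation mon := word_mon.
Local Notation wt := word_wt.
Local Notation std := word_std.

Lemma word_monD v w : mon (v + w) = mon v * mon w.
Proof.
rewrite /word_mon -big_split /=; apply: eq_bigr => i _.
by rewrite mnmDE exprD.
Qed.

Lemma word_mon1 i : mon U_(i) = y i.
Proof.
rewrite /word_mon (bigD1 i) //= mnm1E eqxx expr1 big1 ?mulr1 // => j ne.
by rewrite mnm1E eq_sym (negbTE ne) expr0.
Qed.

Lemma word_mon0 : mon 0%MM = 1.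
Proof. by rewrite /word_mon big1 // => i _; rewrite mnm0E expr0. Qed.

Lemma word_wtD v w : wt (v + w) = (wt v + wt w)%N.
Proof.
rewrite /word_wt -big_split /=; apply: eq_bigr => i _.
by rewrite mnmDE mulnDl.
Qed.

Lemma word_wt1 i : wt U_(i) = om i.
Proof.
rewrite /word_wt (bigD1 i) //= mnm1E eqxx mul1n big1 ?addn0 // => j ne.
by rewrite mnm1E eq_sym (negbTE ne).
Qed.

Lemma word_stdP w :
  reflect (forall i j, (U_(i) + U_(j) <= w)%MM -> good i j) (std w).
Proof.
apply: (iffP idP) => [/forallP H i j le|H].
  by have /forallP /(_ j) /implyP := H i; apply.
by apply/forallP => i; apply/forallP => j; apply/implyP; apply: H.
Qed.

Lemma word_std_le v w : (v <= w)%MM -> std w -> std v.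
Proof.
move=> le /word_stdP H; apply/word_stdP => i j le'.
by apply: H; apply: lepm_trans le' le.
Qed.

Lemma mnm1_add_le (w : 'X_{1..N}) i j :
  (0 < w i)%N -> (0 < w j)%N -> i != j -> (U_(i) + U_(j) <= w)%MM.
Proof.
move=> wi wj ne; apply/mnm_lepP => k; rewrite mnmDE !mnm1E.
case: (eqVneq i k) => [<-|_]; first by rewrite eq_sym (negbTE ne) addn0.
by case: (eqVneq j k) => [<-|].
Qed.

Lemma word_std_small w : (mdeg w <= 1)%N -> std w.
Proof.
move=> le; apply/word_stdP => i j /submK e.
by move: le; rewrite -e !mdegD !mdeg1 addnC.
Qed.

Hypothesis good_sym : forall i j, good i j = good j i.
(** [cf] plays the role of the coordinate functions of the basis of standard words, and [mon_nf]
    that of the terminating, length-preserving rewriting supplied by a quadratic Gröbner basis. *)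
Hypothesis cf_lin : forall w c a b, cf (c *: a + b) w = c * cf a w + cf b w.
Hypothesis cf_mon : forall w v, std w -> cf (mon w) v = (w == v)%:R.
Hypothesis mon_span : forall a, exists r : seq (K * 'X_{1..N}),
  (forall p, p \in r -> std p.2) /\ a = \sum_(p <- r) p.1 *: mon p.2.
Hypothesis mon_nf : forall w, exists v, [/\ std v, mdeg v = mdeg w,
  mon v = mon w, (wt v <= wt w)%N & ~~ std w -> (wt v < wt w)%N].

Lemma cf0 w : cf 0 w = 0.
Proof. by have := cf_lin w (-1) 0 0; rewrite scaler0 addr0 mulN1r addNr. Qed.

Lemma cfD w a b : cf (a + b) w = cf a w + cf b w.
Proof. by rewrite -[a]scale1r cf_lin mul1r scale1r. Qed.

Lemma cfZ w c a : cf (c *: a) w = c * cf a w.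
Proof. by rewrite -[c *: a]addr0 cf_lin cf0 addr0. Qed.

Lemma cf_sum w (I : Type) (r : seq I) (P : pred I) (F : I -> A) :
  cf (\sum_(i <- r | P i) F i) w = \sum_(i <- r | P i) cf (F i) w.
Proof.
elim/big_rec2: _ => [|i a b _ <-]; [exact: cf0 | by rewrite cfD].
Qed.

Lemma mon_expansion a : exists r : seq 'X_{1..N},
  [/\ uniq r, forall w, w \in r -> std w /\ cf a w != 0
    & a = \sum_(w <- r) cf a w *: mon w].
Proof.
have [r0 [std_r0 ea]] := mon_span a.
have cfE w : cf a w = \sum_(p <- r0) p.1 * (p.2 == w)%:R.
  rewrite {1}ea cf_sum; apply: eq_big_seq => p pr.
  by rewrite cfZ cf_mon ?std_r0.
exists [seq w <- undup (map snd r0) | cf a w != 0]; split.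
- by rewrite filter_uniq ?undup_uniq.
- move=> w; rewrite mem_filter mem_undup => /andP [nz /mapP [p pr e]].
  by split=> //; rewrite e; apply: std_r0.
- rewrite big_filter big_mkcond /=.
  rewrite [LHS]ea.
  under [RHS]eq_bigr => w _.
    rewrite (_ : (if _ then _ else _) = cf a w *: mon w); last first.
      by case: eqP => // ->; rewrite scale0r.
    rewrite cfE scaler_suml; over.
  rewrite exchange_big /=; apply: eq_big_seq => p pr.
  rewrite (bigD1_seq p.2) ?undup_uniq ?mem_undup ?map_f //= eqxx mulr1.
  rewrite big1 ?addr0 // => w ne.
  by rewrite eq_sym (negbTE ne) mulr0 scale0r.
Qed.

Lemma cf_std a w : cf a w != 0 -> std w.
Proof.
apply: contraTT => nstd; have [r [_ sr ->]] := mon_expansion a.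
rewrite negbK cf_sum big_seq big1 // => v vr.
rewrite cfZ cf_mon; last by case: (sr _ vr).
case: eqP => [e|_]; last by rewrite mulr0.
by case: (sr _ vr) nstd => + _; rewrite e => ->.
Qed.

Lemma cf_inj a : (forall w, cf a w = 0) -> a = 0.
Proof.
move=> H; have [r [_ _ ->]] := mon_expansion a.
by apply: big1 => w _; rewrite H scale0r.
Qed.

(** * Supports of vectors over the basis of standard words *)

Section Vectors.
Variable b : nat.
Implicit Types (f g : 'rV[A]_b) (P Q : 'I_b -> 'X_{1..N} -> Prop).

Definition vsupp P f := forall j w, cf (f 0 j) w != 0 -> P j w.
Definition vterm (j : 'I_b) w : 'rV[A]_b := mon w *: delta_mx 0 j.

Lemma vsupp0 P : vsupp P 0.
Proof. by move=> j w; rewrite mxE cf0 eqxx. Qed.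

Lemma vsuppD P f g : vsupp P f -> vsupp P g -> vsupp P (f + g).
Proof.
move=> Hf Hg j w; rewrite mxE cfD => nz.
case: (eqVneq (cf (f 0 j) w) 0) => [e|/Hf //].
by apply: Hg; move: nz; rewrite e add0r.
Qed.

Lemma vsuppZ P (c : K) f : vsupp P f -> vsupp P (c%:A *: f).
Proof.
move=> Hf j w; rewrite mxE mulr_algl cfZ mulf_eq0 negb_or.
by case/andP => _ /Hf.
Qed.

Lemma vsuppB P f g : vsupp P f -> vsupp P g -> vsupp P (f - g).
Proof.
move=> Hf Hg; apply: vsuppD => //; rewrite -scaleN1r.
rewrite (_ : -1 = (-1)%:A); first exact: vsuppZ.
by rewrite scaleN1r.
Qed.

Lemma vsupp_sub P Q f :
  (forall j w, std w -> P j w -> Q j w) -> vsupp P f -> vsupp Q f.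
Proof. by move=> PQ Hf j w nz; apply: PQ; [apply: cf_std nz | apply: Hf]. Qed.

Lemma vsupp_term P j w : std w -> P j w -> vsupp P (vterm j w).
Proof.
move=> sw Pw k v; rewrite !mxE eqxx /=.
case: (eqVneq k j) => [->|_]; last by rewrite mulr0 cf0 eqxx.
rewrite mulr1 cf_mon //; case: (eqVneq w v) => [<- //|_]; by rewrite eqxx.
Qed.

(** The vectors supported on [P] are the K-span of the standard terms in [P], so a linear property
    needs checking on terms only. *)
Lemma vsupp_ind P (Q : 'rV[A]_b -> Prop) f :
    Q 0 -> (forall f g, Q f -> Q g -> Q (f + g)) ->
    (forall c f, Q f -> Q (c%:A *: f)) ->
    (forall j w, std w -> P j w -> Q (vterm j w)) ->
  vsupp P f -> Q f.
Proof.
move=> Q0 QD QZ Qt Hf.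
have -> : f = \sum_j f 0 j *: delta_mx 0 j.
  by rewrite {1}(matrix_sum_delta f) big_ord1.
apply: big_ind => // j _.
have [r [_ sr ef]] := mon_expansion (f 0 j).
rewrite ef scaler_suml big_seq; apply: big_ind => // w wr.
have [sw nz] := sr _ wr.
rewrite -mulr_algl -scalerA; apply: QZ; apply: Qt => //; exact: Hf.
Qed.

(** A product of two standard words need not be standard. Its normal form keeps the degree and does
    not raise the weight, and nothing more about [u] is available. *)
Lemma vsupp_mul P Q v f : vsupp P f ->
    (forall j w u, P j w -> std w -> std u -> mdeg u = (mdeg v + mdeg w)%N ->
       (wt u <= wt v + wt w)%N -> Q j u) ->
  vsupp Q (mon v *: f).
Proof.
move=> Hf PQ.
apply: (@vsupp_ind P (fun h => vsupp Q (mon v *: h))) Hf => [|g h|c h|j w sw Pw].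
- by rewrite scaler0; apply: vsupp0.
- by rewrite scalerDr; apply: vsuppD.
- by rewrite scalerA mulrC -scalerA; apply: vsuppZ.
have [u [su du mu wu _]] := mon_nf (v + w).
rewrite /vterm scalerA -word_monD -mu.
apply: vsupp_term => //; apply: (PQ j w u) => //; first by rewrite du mdegD.
by rewrite -word_wtD.
Qed.

End Vectors.

(* A free module with its basis weighted by [lshift], a set [lnn j] of letters
   for each basis element, and a submodule [lker] whose leading terms are the
   [w e_j] where the word [w] meets [lnn j]; the terms avoiding [lnn j] form a
   basis of the quotient. *)
Record layer := Layer {
  lrank : nat;
  lscale : nat;
  lshift : 'I_lrank -> nat;
  lnn : 'I_lrank -> {set 'I_N};
  lker : 'rV[A]_lrank -> Prop
}.

Definition lkey (L : layer) (j : 'I_(lrank L)) w : nat :=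
  (lscale L * wt w + lshift j)%N.

Definition lnormal (L : layer) (j : 'I_(lrank L)) w : Prop :=
  forall i, i \in lnn j -> w i = 0%N.

Record layer_ok (L : layer) : Prop := LayerOk {
  lker0 : lker (0 : 'rV_(lrank L));
  lkerD : forall f g : 'rV_(lrank L), lker f -> lker g -> lker (f + g);
  lkerZ : forall a (f : 'rV_(lrank L)), lker f -> lker (a *: f);
  lscale_gt0 : (0 < lscale L)%N;
  llead : forall (j : 'I_(lrank L)) i, i \in lnn j -> exists z : 'rV_(lrank L),
    [/\ lker z, vsupp (fun _ w => mdeg w = 1%N) z &
      vsupp (fun j' w => (lkey j' w < lkey j U_(i))%N) (z - vterm j U_(i))];
  lindep : forall f : 'rV_(lrank L), lker f -> vsupp (@lnormal L) f -> f = 0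
}.

(** * The syzygies of a layer as the next layer *)

Section NextLayer.
Variables (L : layer).
Local Notation b := (lrank L).

Definition lnext_index : {set 'I_b * 'I_N} := [set x | x.2 \in lnn x.1].

Lemma lnext_indexP j i : i \in @lnn L j -> exists t : 'I_#|lnext_index|, enum_val t = (j, i).
Proof.
move=> ij; have x_in : (j, i) \in lnext_index by rewrite inE.
by exists (enum_rank_in x_in (j, i)); rewrite enum_rankK_in.
Qed.

Lemma lnext_index_mem (t : 'I_#|lnext_index|) :
  (enum_val t).2 \in @lnn L (enum_val t).1.
Proof. by have := enum_valP t; rewrite inE. Qed.

Definition lead_matrix (Z : 'M[A]_(#|lnext_index|, b)) : Prop :=
  forall t, let: (j, i) := enum_val t in
    [/\ lker (row t Z), vsupp (fun _ w => mdeg w = 1%N) (row t Z) &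
      vsupp (fun j' w => (lkey j' w < lkey j U_(i))%N) (row t Z - vterm j U_(i))].

(* A basis element over [(j, i)] has the weight of [y i *: e_j]; scaling all
   keys by [N.+1] leaves room to break ties by [i]. *)
Definition lnext (Z : 'M[A]_(#|lnext_index|, b)) : layer :=
  @Layer #|lnext_index| (N.+1 * lscale L)
    (fun t => N.+1 * lkey (enum_val t).1 U_((enum_val t).2) + (enum_val t).2)%N
    (fun t => [set m | ~~ good m (enum_val t).2 ||
                       (m \in lnn (enum_val t).1) && (m < (enum_val t).2)%N])
    (fun g => g *m Z = 0).

Hypothesis okL : layer_ok L.

Lemma lead_matrix_exists : exists Z, lead_matrix Z.
Proof.
have H (t : 'I_#|lnext_index|) := llead okL (lnext_index_mem t).
have [z Hz] := choice H.
exists (\matrix_t z t) => t; move: (Hz t); rewrite rowK.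
by case: (enum_val t).
Qed.

Variable Z : 'M[A]_(#|lnext_index|, b).
Hypothesis leadZ : lead_matrix Z.

Lemma vterm_mulmx t w : @vterm #|lnext_index| t w *m Z = mon w *: row t Z.
Proof. by rewrite /vterm -scalemxAl rowE. Qed.

Lemma lkeyD (M : layer) j v w : @lkey M j (v + w) = (lscale M * wt v + lkey j w)%N.
Proof. by rewrite /lkey word_wtD mulnDr addnA. Qed.

Lemma lkey_next (t : 'I_#|lnext_index|) w :
  @lkey (lnext Z) t w =
    (N.+1 * lkey (enum_val t).1 (w + U_((enum_val t).2)) + (enum_val t).2)%N.
Proof. by rewrite [in RHS]lkeyD {1}/lkey /= mulnDr mulnA addnA. Qed.

(** Division with remainder by the rows of [Z]: [r] is the remainder, and [Q] bounds the terms of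
    the quotient [g]. *)
Definition reduces (Q : 'I_#|lnext_index| -> 'X_{1..N} -> Prop) f :=
  exists r g, [/\ f = r + g *m Z, vsupp (@lnormal L) r & vsupp Q g].

Lemma reduces_ind P Q f :
    (forall j w, std w -> P j w -> reduces Q (vterm j w)) ->
  vsupp P f -> reduces Q f.
Proof.
move=> Ht; apply: vsupp_ind => [|h k|c h|//].
- by exists 0, 0; split; rewrite ?mul0mx ?addr0 //; apply: vsupp0.
- move=> [r [g [-> nr Qg]]] [r' [g' [-> nr' Qg']]].
  exists (r + r'), (g + g'); rewrite mulmxDl addrACA.
  by split=> //; apply: vsuppD.
- move=> [r [g [-> nr Qg]]]; exists (c%:A *: r), (c%:A *: g).
  by rewrite scalerDr -scalemxAl; split=> //; apply: vsuppZ.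
Qed.

(** Keys are additive and normal forms do not raise weights, so the terms of a row below its leading
    term stay below after multiplication by a word. *)
Lemma vsupp_lower (t : 'I_#|lnext_index|) v :
  vsupp (fun j' u => (lkey j' u < lkey (enum_val t).1 (v + U_((enum_val t).2)))%N /\
                     mdeg u = (mdeg v).+1)
    (mon v *: (row t Z - vterm (enum_val t).1 U_((enum_val t).2))).
Proof.
have := leadZ t; case: (enum_val t) => j i /= [_ deg1 low].
have Hz : vsupp (fun j' u => (lkey j' u < lkey j U_(i))%N /\ mdeg u = 1%N)
                (row t Z - vterm j U_(i)).
  move=> j' u nz; split; first exact: low nz.
  apply: (vsuppB deg1) nz; apply: vsupp_term; last exact: mdeg1.
  by rewrite word_std_small // mdeg1.
apply: vsupp_mul Hz _ => j' u0 u [low0 d0] _ _ -> wu.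
split; last by rewrite d0 addn1.
rewrite lkeyD (leq_ltn_trans _ (_ : lscale L * wt v + lkey j' u0 < _))%N //.
  by rewrite -lkeyD /lkey leq_add2r word_wtD leq_mul2l wu orbT.
by rewrite ltn_add2l.
Qed.

(** Induction on the key: if [w] meets [lnn j], subtracting a multiple of a row removes the term and
    leaves terms of smaller key. *)
Lemma reduces_term j w : std w ->
  reduces (fun t u => [/\ @lnormal (lnext Z) t u,
    (@lkey (lnext Z) t u < N.+1 * (lkey j w).+1)%N & (mdeg u).+1 = mdeg w])
  (vterm j w).
Proof.
have [n] := ubnP (lkey j w); elim: n j w => // n IH j w.
rewrite ltnS => le_n sw.
have [/existsP /= [i0 i0P]|/existsPn /= nnP] :=
  boolP [exists i, (i \in lnn j) && (w i != 0%N)]; last first.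
  exists (vterm j w), 0; rewrite mul0mx addr0; split=> //; last exact: vsupp0.
  apply: vsupp_term => // i ij.
  by have := nnP i; rewrite ij /= negbK => /eqP.
(* Dividing out the least possible letter leaves a quotient without smaller letters of [lnn j]. As
   [w] is standard, all its letters are good with [i], so the quotient is normal in the next
   layer. *)
have [i /andP [ij wi] imin] := @arg_minnP _ i0 (fun i => (i \in lnn j) && (w i != 0%N)) val i0P.
have [t et] := lnext_indexP ij.
pose v := (w - U_(i))%MM.
have ew : w = (v + U_(i))%MM by rewrite submK // lep1mP.
have := @vsupp_lower t v; rewrite et /= -ew => low.
have dw : mdeg w = (mdeg v).+1 by rewrite ew mdegD mdeg1 addn1.
have [r [g [eh nr Qg]]] : reduces (fun t u => [/\ @lnormal (lnext Z) t u,
    (@lkey (lnext Z) t u < N.+1 * (lkey j w))%N & (mdeg u).+1 = mdeg w])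
    (mon v *: (row t Z - vterm j U_(i))).
  apply: reduces_ind low => j' u su [ku du].
  have [r [g [e nr Qg]]] := IH j' u (leq_trans ku le_n) su.
  exists r, g; split=> //; apply: vsupp_sub Qg => t' u' _ [nu ku' du'].
  split=> //; last by rewrite du' du.
  by apply: leq_trans ku' _; rewrite leq_mul2l ku orbT.
exists (- r), (vterm t v - g); split.
- have : vterm j w = mon v *: row t Z - mon v *: (row t Z - vterm j U_(i)).
    by rewrite -scalerBr subKr /vterm scalerA -word_monD -ew.
  rewrite eh => ->.
  by rewrite mulmxBl vterm_mulmx opprD addrCA.
- rewrite -sub0r; apply: vsuppB => //; exact: vsupp0.
apply: vsuppB; last first.
  apply: vsupp_sub Qg => t' u' _ [nu ku' du']; split=> //.
  by apply: leq_trans ku' _; rewrite leq_mul2l leqnSn orbT.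
apply: vsupp_term; first by apply: word_std_le sw; rewrite ew lem_addr.
split; last by rewrite dw.
- rewrite /lnormal /= et => m; rewrite inE /= => badm.
  case: (posnP (v m)) => // vm; exfalso.
  case/orP: badm => [bad|/andP [mj mi]]; last first.
    have := imin m; rewrite mj ew mnmDE addn_eq0 eqn0Ngt vm /= => /(_ isT).
    by rewrite leqNgt mi.
  case/negP: bad; move/word_stdP: sw; apply.
  rewrite ew; apply/mnm_lepP => k; rewrite !mnmDE leq_add2r mnm1E.
  by case: (eqVneq m k) => [<-|].
- rewrite lkey_next et /= -ew mulnS; have := ltn_ord i; lia.
Qed.

Lemma lker_generated f : lker f -> exists g, f = g *m Z.
Proof.
move=> kf.
have [r [g [ef nr _]]] : reduces (fun _ _ => True) f.
  apply: (@reduces_ind (fun _ _ => True)) => // j w sw _.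
  have [r [g [e nr _]]] := reduces_term j sw.
  by exists r, g; split.
(* The remainder is a difference of two kernel elements and is normal, so it vanishes. *)
exists g; rewrite ef (lindep okL (f := r)) ?add0r //.
have -> : r = f + (-1) *: (g *m Z) by rewrite scaleN1r ef addrK.
apply: lkerD => //; apply: lkerZ => //.
rewrite mulmx_sum_row; elim/big_ind: _; [exact: lker0|exact: lkerD|move=> t _].
by apply: lkerZ => //; have := leadZ t; case: (enum_val t) => j i [].
Qed.

Lemma lker_mulmx g : lker (g *m Z).
Proof.
rewrite mulmx_sum_row; elim/big_ind: _; [exact: lker0|exact: lkerD|move=> t _].
by apply: lkerZ => //; have := leadZ t; case: (enum_val t) => j i [].
Qed.
(** The quotient inherits the bounds on key and degree. This turns a combination of rows with no
    leading term into a syzygy with a prescribed leading term. *)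
Lemma lker_reduces kap e f :
    lker f -> vsupp (fun j w => (lkey j w < kap)%N /\ mdeg w = e) f ->
  exists2 g, f = g *m Z &
    vsupp (fun t u => (@lkey (lnext Z) t u < N.+1 * kap)%N /\ (mdeg u).+1 = e) g.
Proof.
move=> kf Hf.
have [r [g [ef nr Qg]]] : reduces (fun t u =>
    (@lkey (lnext Z) t u < N.+1 * kap)%N /\ (mdeg u).+1 = e) f.
  apply: reduces_ind Hf => j w sw [kw dw].
  have [r [g [e1 nr Qg]]] := reduces_term j sw.
  exists r, g; split=> //; apply: vsupp_sub Qg => t u _ [_ ku du].
  split; last by rewrite du.
  by apply: leq_trans ku _; rewrite leq_mul2l kw orbT.
exists g => //; rewrite {1}ef (lindep okL (f := r)) ?add0r //.
have -> : r = f + (-1) *: (g *m Z) by rewrite scaleN1r ef addrK.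
by apply: lkerD => //; apply: lkerZ => //; apply: lker_mulmx.
Qed.

(** As in Schreyer's construction, [y_m] times row [t] is modified to a kernel element [f] with keys
    below [kap]. Lifting [f] through [Z] and subtracting gives a syzygy led by [y_m e_t]. *)
Lemma lnext_lead (t : 'I_#|lnext_index|) m : m \in @lnn (lnext Z) t ->
  exists z : 'rV_#|lnext_index|, [/\ z *m Z = 0, vsupp (fun _ w => mdeg w = 1%N) z &
    vsupp (fun t' w => (@lkey (lnext Z) t' w < @lkey (lnext Z) t U_(m))%N)
          (z - vterm t U_(m))].
Proof.
pose j := (enum_val t).1; pose i := (enum_val t).2.
pose kap := lkey j (U_(m) + U_(i)).
move=> mt; suff [f [g [ef Hg kf Hf]]] : exists (f : 'rV_b) (g : 'rV_#|lnext_index|), [/\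
    f = mon U_(m) *: row t Z - g *m Z,
    vsupp (fun t' u => (@lkey (lnext Z) t' u < @lkey (lnext Z) t U_(m))%N /\
                       mdeg u = 1%N) g,
    lker f & vsupp (fun j w => (lkey j w < kap)%N /\ mdeg w = 2%N) f].
  have [g' ef' Hg'] := lker_reduces kf Hf.
  have Hgg : vsupp (fun t' u => (@lkey (lnext Z) t' u < @lkey (lnext Z) t U_(m))%N /\
                       mdeg u = 1%N) (g + g').
    apply: vsuppD => //; apply: vsupp_sub Hg' => t' u _ [ku [du]].
    by split=> //; rewrite [X in (_ < X)%N]lkey_next (leq_trans ku) // leq_addr.
  exists (vterm t U_(m) - (g + g')); split.
  - by rewrite mulmxBl mulmxDl vterm_mulmx -ef' ef [_ + (_ - _)]addrC subrK subrr.
  - apply: vsuppB; first by apply: vsupp_term; rewrite ?word_std_small ?mdeg1.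
    by apply: vsupp_sub Hgg => ? ? _ [].
  - rewrite addrAC subrr sub0r -sub0r; apply: vsuppB; first exact: vsupp0.
    by apply: vsupp_sub Hgg => ? ? _ [].
have low := @vsupp_lower t U_(m); rewrite mdeg1 -/j -/i -/kap in low.
have kerrow s : lker (row s Z).
  by have := leadZ s; case: (enum_val s) => ? ? [].
(* For a bad pair the leading word [y_m y_i] itself rewrites to a word of smaller weight. *)
case: (boolP (good m i)) => [gd|bad]; last first.
  exists (mon U_(m) *: row t Z), 0; split; rewrite ?mul0mx ?subr0 //; first exact: vsupp0.
    by apply: lkerZ.
  have -> : mon U_(m) *: row t Z = mon U_(m) *: (row t Z - vterm j U_(i)) +
       vterm j (U_(m) + U_(i)) by rewrite scalerBr /vterm scalerA -word_monD subrK.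
  apply: vsuppD => //; have [v [sv dv mv _ wv]] := mon_nf (U_(m) + U_(i)).
  rewrite /vterm -mv; apply: vsupp_term => //; split; last by rewrite dv mdegD !mdeg1.
  rewrite /kap /lkey ltn_add2r ltn_pmul2l ?lscale_gt0 //; apply: wv.
  by apply: contra bad => /word_stdP; apply; apply: lepm_refl.
have [mj mi] : m \in lnn j /\ (m < i)%N.
  by move: mt; rewrite inE /= gd /= => /andP [].
have [s es] := lnext_indexP mj.
have := @vsupp_lower s U_(i); rewrite es /= mdeg1 => low'.
(* The leading terms of the two multiples coincide. In the next layer [y_i e_s] and [y_m e_t] have
   the same scaled key, and the tie is broken by [m < i]. *)
exists (mon U_(m) *: row t Z - mon U_(i) *: row s Z), (vterm s U_(i)); split.
- by rewrite vterm_mulmx.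
- apply: vsupp_term; first by rewrite word_std_small ?mdeg1.
  by rewrite !lkey_next es /= addmC mdeg1 ltn_add2l.
- by apply: lkerD => //; [|rewrite -scaleN1r]; do ?apply: lkerZ => //.
- have -> : mon U_(m) *: row t Z - mon U_(i) *: row s Z =
      mon U_(m) *: (row t Z - vterm j U_(i)) - mon U_(i) *: (row s Z - vterm j U_(m)).
    by rewrite !scalerBr /vterm !scalerA -!word_monD [(U_(i) + _)%MM]addmC opprB addrA subrK.
  apply: vsuppB => //; move: low'; rewrite addmC; exact.
Qed.

(** Normality excludes the letters that are bad with the new one, so the leading term of the image
    of a normal term needs no rewriting. *)
Lemma lnormal_std (t : 'I_#|lnext_index|) v :
  std v -> @lnormal (lnext Z) t v -> std (v + U_((enum_val t).2)).
Proof.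
set i := (enum_val t).2 => sv nv; apply/word_stdP => a c /mnm_lepP le.
have gdi k : v k != 0%N -> good k i.
  move=> vk; apply: contraNT vk => bad; apply/eqP/nv.
  by rewrite inE bad.
case: (eqVneq a i) => [ea|ai].
  rewrite good_sym ea; apply: gdi.
  by have := le c; rewrite !mnmDE ea [U_(c)%MM c]mnm1E eqxx addnC leq_add2r -lt0n.
case: (eqVneq c i) => [ec|ci].
  rewrite ec; apply: gdi.
  by have := le a; rewrite !mnmDE ec [U_(a)%MM a]mnm1E eqxx leq_add2r -lt0n.
move/word_stdP: sv; apply; apply/mnm_lepP => k; have := le k.
rewrite !mnmDE !mnm1E; case: (eqVneq i k) => [<-|]; last by rewrite addn0.
by rewrite (negbTE ai) (negbTE ci).
Qed.

(** The appended letter is the least letter of [lnn j] in the product and can be recovered from it.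
    Distinct normal terms thus have distinct leading terms. *)
Lemma lnormal_inj (t s : 'I_#|lnext_index|) (u v : 'X_{1..N}) :
    @lnormal (lnext Z) t u -> @lnormal (lnext Z) s v ->
    (enum_val t).1 = (enum_val s).1 ->
    (u + U_((enum_val t).2) = v + U_((enum_val s).2))%MM ->
  t = s /\ u = v.
Proof.
have aux (t' s' : 'I_#|lnext_index|) (u' v' : 'X_{1..N}) : @lnormal (lnext Z) s' v' ->
    (enum_val t').1 = (enum_val s').1 ->
    (u' + U_((enum_val t').2) = v' + U_((enum_val s').2))%MM ->
    ~ ((enum_val t').2 < (enum_val s').2)%N.
  move=> ns ej /mnmP /(_ (enum_val t').2) e lt.
  have := ns (enum_val t').2; rewrite inE lt -ej lnext_index_mem /= orbT => /(_ isT) v0.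
  move: e; rewrite !mnmDE v0 !mnm1E eqxx addn1.
  by case: eqP => // e; rewrite e ltnn in lt.
move=> nu nv ej e.
have ei : (enum_val t).2 = (enum_val s).2.
  apply/ord_inj; case: (ltngtP (enum_val t).2 (enum_val s).2) => // lt; exfalso.
    exact: (@aux t s u v nv ej e lt).
  exact: (@aux s t v u nu (esym ej) (esym e) lt).
split; last by move: e; rewrite ei => /addIm.
by apply/enum_val_inj; move: ej ei; case: (enum_val t) (enum_val s) => ? ? [? ?] /= -> ->.
Qed.

(** A term of greatest key in [g] cannot be cancelled in [g *m Z]: the other leading terms differ
    from its own, and the remaining terms lie strictly lower. Descent on a bound for the keys then
    gives [g = 0]. *)
Lemma lnext_lindep (g : 'rV_#|lnext_index|) :
  g *m Z = 0 -> vsupp (@lnormal (lnext Z)) g -> g = 0.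
Proof.
pose key (t : 'I_#|lnext_index|) u := lkey (enum_val t).1 (u + U_((enum_val t).2)).
move=> gZ ng.
have [kap] : exists kap, vsupp (fun t u => key t u < kap)%N g.
  have : vsupp (fun _ _ => True) g by [].
  apply: (@vsupp_ind #|lnext_index| (fun _ _ => True)
            (fun h => exists kap, vsupp (fun t u => key t u < kap)%N h)) => [|h k|c h|t u su _].
  - by exists 0%N; apply: vsupp0.
  - move=> [k1 H1] [k2 H2]; exists (maxn k1 k2).
    by apply: vsuppD; [apply: vsupp_sub H1|apply: vsupp_sub H2] => t u _ lt;
       rewrite leq_max lt ?orbT.
  - by move=> [k1 H1]; exists k1; apply: vsuppZ.
  - by exists (key t u).+1; apply: vsupp_term.
elim: kap => [|kap IH] Hk.
  apply/rowP => t; rewrite mxE; apply: cf_inj => u; apply/eqP/negP => /negP nz.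
  by have := Hk t u nz; rewrite ltn0.
apply: IH => t u nz; rewrite ltn_neqAle -ltnS Hk // andbT; apply/eqP => ek.
suff : cf ((g *m Z) 0 (enum_val t).1) (u + U_((enum_val t).2)) = cf (g 0 t) u.
  by rewrite gZ mxE cf0 => e; rewrite -e eqxx in nz.
have nu := ng _ _ nz.
have : vsupp (fun s v => @lnormal (lnext Z) s v /\ (key s v <= kap)%N) g.
  by move=> s v nz'; split; [apply: ng | rewrite -ltnS; apply: Hk].
apply: (@vsupp_ind #|lnext_index| (fun s v => @lnormal (lnext Z) s v /\ (key s v <= kap)%N)
  (fun h => cf ((h *m Z) 0 (enum_val t).1) (u + U_((enum_val t).2)) = cf (h 0 t) u))
  => [|h k eh ek'|c h eh|s v sv [nv kv]].
- by rewrite mul0mx !mxE !cf0.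
- by rewrite mulmxDl !mxE !cfD; move: eh ek'; rewrite !mxE => -> ->.
- rewrite -scalemxAl mxE [in RHS]mxE !mulr_algl !cfZ eh; by [].
rewrite vterm_mulmx -(subrK (vterm (enum_val s).1 U_((enum_val s).2)) (row s Z)) scalerDr.
rewrite mxE cfD (_ : cf (_ 0 _) _ = 0) ?add0r; last first.
  apply/eqP/negP => /negP /(@vsupp_lower s v) [].
  by rewrite -/(key s v) -/(key t u) ek ltnNge kv.
rewrite /vterm scalerA -word_monD !mxE eqxx /=.
case: (eqVneq t s) nv => [<- nv|ne nv].
  by rewrite eqxx !mulr1 !cf_mon ?lnormal_std ?eqm_add2r.
rewrite mulr0 cf0; case: eqP => [ej|_]; last by rewrite mulr0 cf0.
rewrite mulr1 cf_mon ?lnormal_std //; case: eqP => // e.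
by case: (lnormal_inj nv nu (esym ej) e) => es _; rewrite es eqxx in ne.
Qed.
Lemma lnext_ok : layer_ok (lnext Z).
Proof.
split=> [|f g|a f||t m|f].
- exact: mul0mx.
- by rewrite /= mulmxDl => -> ->; rewrite addr0.
- by rewrite /= -scalemxAl => ->; rewrite scaler0.
- by rewrite /= muln_gt0 lscale_gt0.
- exact: lnext_lead.
- exact: lnext_lindep.
Qed.

End NextLayer.

(** The differentials are lead matrices of the iterated layers. The kernel of each new layer is by
    definition that of the last differential, so exactness is [lker_generated], and linearity is the
    degree condition in [lead_matrix]. *)
Theorem layer_linear_resolution (grA : nat -> set A) (M : lmodType A)
    (grM : nat -> set M) (L : layer) (e : 'I_(lrank L) -> M) (q : nat) :
  layer_ok L -> (forall j, grM q (e j)) ->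
  (forall a, (forall w, cf a w != 0 -> mdeg w = 1%N) -> grA 1%N a) ->
  (forall x, exists v : 'rV[A]_(lrank L), \sum_j v 0 j *: e j = x) ->
  (forall v, lker v <-> \sum_j v 0 j *: e j = 0) ->
  has_linear_resolution grA grM.
Proof.
move=> okL gr_e gr1 surj ker_e.
pose Zm (X : {L | layer_ok L}) := sval (cid (lead_matrix_exists (svalP X))).
have ZmP X : lead_matrix (Zm X) by exact: svalP (cid _).
pose nx (X : {L | layer_ok L}) : {L | layer_ok L} :=
  exist _ (lnext (Zm X)) (lnext_ok (svalP X) (ZmP X)).
pose st k := iter k nx (exist _ L okL).
exists q, (fun k => lrank (sval (st k))), e, (fun k => Zm (st k)); split=> //.
- move=> i j k; apply: gr1 => w nz.
  have := ZmP (st i) j; case: (enum_val j) => j' i' [_ deg1 _].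
  by apply: (deg1 k w); rewrite mxE.
- move=> v; rewrite -ker_e; split=> [kv|[w ->]].
    exact: (lker_generated okL (ZmP (st 0)) kv).
  exact: (lker_mulmx okL (ZmP (st 0))).
- move=> i v; split=> [kv|[w ->]].
    exact: (lker_generated (svalP (st i.+1)) (ZmP (st i.+1)) kv).
  exact: (lker_mulmx (svalP (st i.+1)) (ZmP (st i.+1))).
Qed.

(** * The grading by word length and the resolution of the residue field *)

Section Grading.
Variable gr : nat -> set A.
Hypothesis grE : forall d a, gr d a <-> (forall w, cf a w != 0 -> mdeg w = d).

Lemma gr_word_mon w : std w -> gr (mdeg w) (mon w).
Proof.
move=> sw; apply/grE => v; rewrite cf_mon //.
by case: (eqVneq w v) => [->|_]; rewrite ?eqxx.
Qed.

Lemma gr_linear d c a a' : gr d a -> gr d a' -> gr d (c *: a + a').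
Proof.
move=> /grE ga /grE ga'; apply/grE => w; rewrite cfD cfZ => nz.
case: (eqVneq (cf a w) 0) => [e|/ga //].
by apply: ga'; move: nz; rewrite e mulr0 add0r.
Qed.

Lemma gr_zero d : gr d 0.
Proof. by apply/grE => w; rewrite cf0 eqxx. Qed.

Lemma gr_scale d c a : gr d a -> gr d (c *: a).
Proof. by move=> ga; rewrite -[_ *: _]addr0; apply: gr_linear => //; apply: gr_zero. Qed.

Lemma gr_bigsum d (I : Type) (r : seq I) (P : pred I) (F : I -> A) :
  (forall i, P i -> gr d (F i)) -> gr d (\sum_(i <- r | P i) F i).
Proof.
move=> H; elim/big_ind: _ => // [|a a' ga ga']; first exact: gr_zero.
by rewrite -[a]scale1r; apply: gr_linear.
Qed.

Lemma gr_monM w d a : gr d a -> gr (mdeg w + d)%N (mon w * a).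
Proof.
move=> /grE ga; apply/grE => u nz.
have /(@vsupp_mul 1 _ (fun _ u => mdeg u = (mdeg w + d)%N) w) H :
    vsupp (fun _ u => mdeg u = d) (a%:M : 'rV_1).
  by move=> j v; rewrite mxE ord1 eqxx mulr1n; apply: ga.
apply: (H _ 0 u); first by move=> _ v u' -> _ _ ->.
by rewrite !mxE eqxx mulr1n.
Qed.

Lemma gr_bigop_supp (r : seq 'X_{1..N}) (P : pred 'X_{1..N}) c d :
    (forall w, w \in r -> std w /\ (P w -> mdeg w = d)) ->
  gr d (\sum_(w <- r | P w) c w *: mon w).
Proof.
move=> H; rewrite big_seq_cond; apply: gr_bigsum => w /andP [wr Pw].
by have [sw dw] := H w wr; apply: gr_scale; rewrite -(dw Pw); apply: gr_word_mon.
Qed.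

Theorem word_standard_graded : standard_graded gr.
Proof.
split.
- exact: gr_zero.
- exact: gr_linear.
- move=> d e a a' ga ga'; have [r [_ sr ->]] := mon_expansion a.
  rewrite mulr_suml big_seq; apply: gr_bigsum => w wr.
  have [sw nz] := sr w wr; rewrite -scalerAl; apply: gr_scale.
  by move/grE: ga => /(_ w nz) <-; apply: gr_monM.
- move=> a; have [r [_ sr ea]] := mon_expansion a.
  exists (\max_(w <- r) mdeg w).+1, (fun d => \sum_(w <- r | mdeg w == d) cf a w *: mon w).
  split=> [d|].
    by apply: gr_bigop_supp => w wr; split; [case: (sr w wr) | move/eqP].
  rewrite (exchange_big_dep xpredT) //= {1}ea big_seq [RHS]big_seq; apply: eq_bigr => w wr.
  have ltw : (mdeg w < (\max_(w <- r) mdeg w).+1)%N by rewrite ltnS leq_bigmax_seq.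
  rewrite (bigD1 (Ordinal ltw)) ?eqxx //= big1 ?addr0 // => i /andP [/eqP ei ne].
  by case/eqP: ne; apply: ord_inj.
- move=> n s gs e0 d dn; apply: cf_inj => w; apply/eqP/negP => /negP nz.
  have dw : mdeg w = d by move/grE: (gs d); apply.
  have /eqP := cf0 w; rewrite -{1}e0 cf_sum (bigD1 (Ordinal dn)) //= big1 ?addr0 ?(negbTE nz) //.
  move=> i ne; apply/eqP/negP => /negP nz'; case/eqP: ne; apply: ord_inj => /=.
  by rewrite -dw; apply/esym; move/grE: (gs i); apply.
- move=> a; split=> [/grE ga|[c ->]].
    exists (cf a 0%MM); apply/eqP; rewrite -subr_eq0; apply/eqP/cf_inj => w.
    rewrite -scaleNr cfD cfZ -word_mon0 cf_mon ?word_std_small ?mdeg0 //.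
    case: (eqVneq 0%MM w) => [<-|ne]; first by rewrite mulr1 subrr.
    rewrite mulr0 addr0; apply/eqP/negP => /negP /ga /eqP.
    by rewrite mdeg_eq0 eq_sym (negbTE ne).
  by apply: gr_scale; rewrite -word_mon0 -{1}(@mdeg0 N); apply: gr_word_mon;
     rewrite word_std_small ?mdeg0.
- have g1 i : gr 1 (y i).
    by rewrite -word_mon1 -{1}(mdeg1 i); apply: gr_word_mon; rewrite word_std_small ?mdeg1.
  exists N, y; split=> // a /grE ga; exists (fun i => cf a U_(i)).
  apply/eqP; rewrite -subr_eq0; apply/eqP/cf_inj => w.
  rewrite -scaleN1r cfD cfZ cf_sum mulN1r.
  have cfy i : cf (cf a U_(i) *: y i) w = cf a U_(i) * (U_(i)%MM == w)%:R.
    by rewrite cfZ -word_mon1 cf_mon ?word_std_small ?mdeg1.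
  case: (eqVneq (mdeg w) 1%N) => [/eqP /mdeg1P [i /eqP ew]|ne].
    rewrite (bigD1 i) //= cfy ew eqxx mulr1 big1 ?addr0 ?subrr // => j ne.
    by rewrite -ew cfy ew eq_mnm1 (negbTE ne) mulr0.
  rewrite big1 => [|i _]; last first.
    by rewrite cfy; case: (eqVneq U_(i)%MM w) ne => [<-|_ _]; rewrite ?mdeg1 // mulr0.
  by rewrite subr0; apply/eqP/negP => /negP /ga dw; rewrite dw eqxx in ne.
- move=> d a /grE ga; have [r [_ sr ea]] := mon_expansion a.
  have H (t : 'I_(size r)) : exists p : 'I_N * 'X_{1..N},
      (nth 0%MM r t) = (U_(p.1) + p.2)%MM.
    have wr := mem_nth 0%MM (ltn_ord t); have [sw /ga dw] := sr _ wr.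
    have [i wi] : exists i, (nth 0%MM r t) i != 0%N.
      by apply: mnm_neq0_exists; rewrite -mdeg_eq0 dw.
    by exists (i, (nth 0%MM r t - U_(i))%MM); rewrite /= addmC submK // lep1mP.
  have [p Hp] := choice H.
  exists (size r), (fun t => y (p t).1), (fun t : 'I_(size r) => cf a (nth 0%MM r t) *: mon (p t).2); split.
    move=> t; have [sw /ga dw] := sr _ (mem_nth 0%MM (ltn_ord t)).
    split.
      by rewrite -word_mon1 -{1}(mdeg1 (p t).1); apply: gr_word_mon; rewrite word_std_small ?mdeg1.
    have -> : d = mdeg (p t).2 by move: dw; rewrite Hp mdegD mdeg1 => -[].
    apply/gr_scale/gr_word_mon; apply: word_std_le sw.
    by rewrite Hp lem_addl.
  rewrite {1}ea (big_nth 0%MM) big_mkord; apply: eq_bigr => t _.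
  by rewrite -scalerAr {2}Hp word_monD word_mon1.
Qed.
Lemma irrelevant_cf0 a : a \in irrelevant_ideal gr -> cf a 0%MM = 0.
Proof.
case/asboolP => k [r [x [Hx ->]]]; rewrite cf_sum big1 // => i _.
have [d d0 /grE gx] := Hx i.
have [s [_ sr ->]] := mon_expansion (r i).
rewrite mulr_suml cf_sum big1 // => w _; rewrite -scalerAl cfZ.
have /grE gm : gr (mdeg w + d)%N (mon w * x i) by apply: gr_monM; apply/grE.
case: (eqVneq (cf (mon w * x i) 0%MM) 0) => [->|/gm]; first by rewrite mulr0.
by rewrite mdeg0; lia.
Qed.

Local Notation pi_res := (fun a : A => (\pi_(quotmod (irrelevant_ideal gr)) a)%qT).

Lemma pi_res_eq0 a : pi_res a = 0 <-> a \in irrelevant_ideal gr.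
Proof.
have e0 : (\pi_(quotmod (irrelevant_ideal gr)) 0)%qT = 0.
  exact: (raddf0 (\pi_(Quotient.quot (submodule_pred (irrelevant_ideal gr))))%qT).
rewrite -e0; split=> [/eqP|H]; last apply/eqP; by rewrite quotmod_eqE subr0.
Qed.

Lemma pi_res_scale (v : 'rV[A]_1) :
  \sum_j v 0 j *: pi_res 1 = pi_res (v 0 0).
Proof.
rewrite big_ord1 [LHS]qscale_pi; congr (\pi_(quotmod _) _)%qT.
exact: mulr1.
Qed.

(** Every letter lies in the irrelevant ideal, so only the empty word is normal; its class spans the
    residue field. *)
Definition residue_layer : layer :=
  @Layer 1 1 (fun _ => 0%N) (fun _ => [set: 'I_N]%SET)
    (fun v => v 0 0 \in irrelevant_ideal gr).

Lemma residue_layer_ok : layer_ok residue_layer.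
Proof.
have kE (v : 'rV[A]_1) : @lker residue_layer v = (v 0 0 \in irrelevant_ideal gr) by [].
split=> [|f g|a f||j i _|f kf nf] //.
- by rewrite kE mxE; apply: ideal0.
- by rewrite !kE mxE => ? ?; apply: rpredD.
- by rewrite !kE mxE => ?; apply: idealMl.
- have s1 : std U_(i) by rewrite word_std_small ?mdeg1.
  exists (vterm j U_(i)); split.
  + rewrite kE !mxE ord1 !eqxx mulr1 word_mon1; apply: mem_ideal_gen.
    by exists 1%N; rewrite // -word_mon1 -{1}(mdeg1 i); apply: gr_word_mon.
  + by apply: vsupp_term => //; apply: mdeg1.
  + by rewrite subrr; apply: vsupp0.
apply/rowP => j; rewrite ord1 mxE; apply: cf_inj => w.
case: (eqVneq w 0%MM) => [->|ne]; first exact: irrelevant_cf0.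
apply/eqP/negP => /negP /nf nw; case/eqP: ne; apply/mnmP => i.
by rewrite mnm0E; apply: nw; rewrite inE.
Qed.

Theorem word_residue_linear : has_linear_resolution gr (residue_gr gr).
Proof.
apply: (@layer_linear_resolution _ _ _ residue_layer (fun _ => pi_res 1) 0 residue_layer_ok).
- move=> _; exists 1 => //; rewrite -word_mon0 -{1}(@mdeg0 N).
  by apply: gr_word_mon; rewrite word_std_small ?mdeg0.
- by move=> a Ha; apply/grE.
- move=> x; exists (repr x)%:M; rewrite pi_res_scale mxE eqxx mulr1n.
  exact: reprK.
- by move=> v; rewrite pi_res_scale pi_res_eq0.
Qed.
End Grading.
End QuadraticStandardBasis.
(** * Monomial ideals *)

Section MonomialSets.

Variables (K : fieldType) (n : nat).
Local Notation S := {mpoly K[n]}.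
Local Notation mset := ('X_{1..n} -> Prop).
Implicit Types (I J : ideal S) (M : mset) (p q u : 'X_{1..n}).

(** Membership in a monomial ideal is decided on the support, which reduces ideal arithmetic to sets
    of exponents. *)
Definition ideal_of_mset I M : Prop :=
  forall f, f \in I <-> (forall p, f@_p != 0 -> M p).

Definition mset_add M M' : mset :=
  fun p => exists p1 p2, [/\ M p1, M' p2 & p = (p1 + p2)%MM].

(** The base case is the set of all monomials because the zeroth power is the unit ideal. *)
Fixpoint mset_exp M (a : nat) : mset :=
  if a is b.+1 then mset_add M (mset_exp M b) else fun _ => True.

Definition mset_borel M : Prop :=
  forall p (i j : 'I_n), M p -> (0 < p i)%N -> (j < i)%N -> M (p - U_(i) + U_(j))%MM.

Definition mset_gen M (d : nat) : Prop :=
  forall p, M p -> exists u, [/\ M u, (u <= p)%MM & mdeg u = d].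

Lemma ideal_monomials I f : (forall p, f@_p != 0 -> 'X_[p] \in I) -> f \in I.
Proof.
move=> H; rewrite [f]mpolyE big_seq; apply: ideal_sum => p pf.
by rewrite -mul_mpolyC; apply/idealMl/H; rewrite -mcoeff_msupp.
Qed.

Lemma ideal_of_msetX I M p : ideal_of_mset I M -> 'X_[p] \in I <-> M p.
Proof.
move=> IM; split=> [/IM /(_ p)|Mp].
  by rewrite mcoeffX eqxx oner_neq0; apply.
apply/IM => q; rewrite mcoeffX; case: (eqVneq p q) => [<- //|_]; by rewrite eqxx.
Qed.

Lemma ideal_of_mset_up I M p q : ideal_of_mset I M -> M p -> M (p + q)%MM.
Proof.
move=> IM /(ideal_of_msetX _ IM) Mp; apply/(ideal_of_msetX _ IM).
by rewrite addmC mpolyXD; apply: idealMl.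
Qed.

Lemma mcoeff_idealP (X : set S) M :
    (forall x p q, X x -> x@_p != 0 -> M (q + p)%MM) ->
  forall f, f \in ideal_gen X -> forall p, f@_p != 0 -> M p.
Proof.
move=> XM f /asboolP [k [r [x [Hx ->]]]] p; rewrite raddf_sum /= => nz.
have /existsP [i] : [exists i, (r i * x i)@_p != 0].
  apply: contraNT nz; rewrite negb_exists => /forallP H.
  by rewrite big1 // => i _; apply/eqP; have := H i; rewrite negbK.
rewrite mcoeffM => nzi.
have /existsP [h /andP [/eqP ep nz2]] : [exists h : 'X_{1..n < (mdeg p).+1, (mdeg p).+1},
    (p == (h.1 + h.2)%MM) && ((x i)@_h.2 != 0)].
  apply: contraNT nzi; rewrite negb_exists => /forallP H.
  rewrite big1 // => h hp; have := H h; rewrite hp /= negbK => /eqP ->.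
  by rewrite mulr0.
by rewrite ep; apply: XM (Hx i) nz2.
Qed.

Lemma ideal_of_mset_gen (X : set 'X_{1..n}) :
  ideal_of_mset (ideal_gen [set 'X_[m] | m in X] : ideal S)
    (fun p => exists2 m, X m & (m <= p)%MM).
Proof.
move=> f; split=> [|H].
  apply: mcoeff_idealP => _ p q [m Xm <-]; rewrite mcoeffX.
  case: (eqVneq m p) => [<- _|_]; last by rewrite eqxx.
  by exists m => //; apply: lem_addl.
apply: ideal_monomials => p /H [m Xm le].
rewrite -(submK le) mpolyXD; apply/idealMl/mem_ideal_gen.
by exists m.
Qed.

Lemma ideal_of_mset_mul I J M M' : ideal_of_mset I M -> ideal_of_mset J M' ->
  ideal_of_mset (ideal_mul I J) (mset_add M M').
Proof.
move=> IM JM f; split=> [|H].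
  apply: mcoeff_idealP => _ p q [x [z [/IM xM /JM zM ->]]].
  rewrite mcoeffM => nz.
  have /existsP [h /andP [/eqP ep /andP [/xM Mx /zM Mz]]] :
    [exists h : 'X_{1..n < (mdeg p).+1, (mdeg p).+1},
    (p == (h.1 + h.2)%MM) && ((x@_h.1 != 0) && (z@_h.2 != 0))].
    apply: contraNT nz; rewrite negb_exists => /forallP H.
    rewrite big1 // => h hp; have := H h; rewrite hp /= negb_and !negbK.
    by case/orP => /eqP ->; rewrite ?mul0r ?mulr0.
  rewrite ep; exists (q + h.1)%MM, h.2; split=> //; last by rewrite addmA.
  by rewrite addmC; apply: ideal_of_mset_up IM Mx.
apply: ideal_monomials => p /H [p1 [p2 [M1 M2 ->]]].
by rewrite mpolyXD; apply: mem_ideal_mul; [apply/(ideal_of_msetX _ IM) | apply/(ideal_of_msetX _ JM)].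
Qed.

Lemma ideal_of_mset_exp I M a : ideal_of_mset I M ->
  ideal_of_mset (ideal_exp I a) (mset_exp M a).
Proof.
move=> IM; elim: a => [|a IHa] /=; last exact: ideal_of_mset_mul.
by move=> f; split=> // _; apply: (mem_ideal_exp0 I).
Qed.

Lemma monomial_ideal_mset I : monomial_ideal I ->
  ideal_of_mset I (fun p => 'X_[p] \in I).
Proof.
case=> X IX f; split=> [|H]; last exact: ideal_monomials.
rewrite IX => /ideal_of_mset_gen H p /H [m Xm le].
by rewrite IX -(submK le) mpolyXD; apply/idealMl/mem_ideal_gen; exists m.
Qed.

(** The variable replaced by a Borel move divides one of the two factors, and the move is made in
    that factor. *)
Lemma mset_borel_add M M' : mset_borel M -> mset_borel M' -> mset_borel (mset_add M M').
Proof.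
move=> bM bM' _ i j [p1 [p2 [M1 M2 ->]]] pos ji.
case: (posnP (p1 i)) => [z|p1i].
  have p2i : (0 < p2 i)%N by move: pos; rewrite mnmDE z.
  exists p1, (p2 - U_(i) + U_(j))%MM; split=> //; first exact: bM'.
  rewrite addmA; congr (_ + _)%MM; apply/mnmP => k; rewrite !mnmDE !mnmBE !mnmDE mnm1E.
  by case: (eqVneq i k) => [<-|_]; lia.
exists (p1 - U_(i) + U_(j))%MM, p2; split=> //; first exact: bM.
apply/mnmP => k; rewrite !mnmDE !mnmBE !mnmDE !mnm1E.
by case: (eqVneq i k) => [<-|_]; lia.
Qed.

Lemma mset_borel_exp M a : mset_borel M -> mset_borel (mset_exp M a).
Proof. by move=> bM; elim: a => //= a IHa; apply: mset_borel_add. Qed.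

Lemma mset_gen_add M M' d d' : mset_gen M d -> mset_gen M' d' ->
  mset_gen (mset_add M M') (d + d').
Proof.
move=> gM gM' _ [p1 [p2 [/gM [u [Mu le du]] /gM' [u' [Mu' le' du']] ->]]].
exists (u + u')%MM; split; [by exists u, u' | | by rewrite mdegD du du'].
apply/mnm_lepP => k; rewrite !mnmDE; apply: leq_add; exact/mnm_lepP.
Qed.

Lemma mset_gen_exp M a d : mset_gen M d -> mset_gen (mset_exp M a) (a * d).
Proof.
move=> gM; elim: a => [|a IHa] /=; last exact: mset_gen_add.
move=> p _; exists 0%MM; rewrite mdeg0; split=> //.
by apply/mnm_lepP => k; rewrite mnm0E.
Qed.

End MonomialSets.
(** * Linear resolutions of strongly stable ideals *)

Lemma mnm_le_mdeg_eq (n : nat) (u v : 'X_{1..n}) :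
  (forall i, (u i <= v i)%N) -> mdeg u = mdeg v -> u = v.
Proof.
move=> le /eqP e; have le' : (u <= v)%MM by apply/mnm_lepP.
move: e; rewrite -(submK le') mdegD -[X in X == _]add0n eqn_add2r eq_sym mdeg_eq0.
by move/eqP => ->; rewrite add0m.
Qed.

(* A monomial of degree at least [d] has at most one factorisation [w * u] with
   [u] of degree [d] and all variables of [w] at or after the last one of [u]. *)
Lemma stable_factor_unique (n : nat) (u u' w w' : 'X_{1..n}) :
    mdeg u = mdeg u' -> (w + u = w' + u')%MM ->
    (forall i k : 'I_n, (i < k)%N -> (0 < u k)%N -> w i = 0%N) ->
    (forall i k : 'I_n, (i < k)%N -> (0 < u' k)%N -> w' i = 0%N) ->
  u = u' /\ w = w'.
Proof.
move=> deg e Hu Hu'; suff eu : u = u' by split=> //; move: e; rewrite eu => /addIm.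
apply/eqP/negP => /negP ne.
have [i0 i0P] : exists i, u i != u' i.
  apply/existsP; apply: contraNT ne; rewrite negb_exists => /forallP H.
  by apply/eqP/mnmP => i; apply/eqP; have := H i; rewrite negbK.
have [i iP imin] := @arg_minnP _ i0 (fun i => u i != u' i) val i0P.
(* At the first position [i] where the two differ, the smaller one leaves [x i] positive, so it has
   no variable after [i]. It then divides the other one, and equal degrees force equality. *)
have aux (v v' x x' : 'X_{1..n}) : mdeg v = mdeg v' -> (x + v = x' + v')%MM ->
    (forall i k : 'I_n, (i < k)%N -> (0 < v k)%N -> x i = 0%N) ->
    (v i < v' i)%N -> (forall k : 'I_n, (k < i)%N -> v k = v' k) -> v = v'.
  move=> dv ev Hv lt low; apply: mnm_le_mdeg_eq => // k.
  case: (ltngtP k i) => [/low -> //|ik|/ord_inj ->]; last exact: ltnW.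
  rewrite leqNgt; apply/negP => vk.
  have := Hv i k ik (leq_ltn_trans (leq0n _) vk).
  by move/mnmP: ev => /(_ i); rewrite !mnmDE => + xi; lia.
have low (k : 'I_n) : (k < i)%N -> u k = u' k.
  move=> ki; apply/eqP; apply: contraTT ki => /imin /=; by rewrite -leqNgt.
case/negP: ne; apply/eqP; case: (ltngtP (u i) (u' i)) => [lt|lt|eq].
- exact: aux deg e Hu lt low.
- by apply/esym; apply: (aux u' u w' w) => // k /low.
- by rewrite eq eqxx in iP.
Qed.

Section StronglyStableResolution.

Variables (K : fieldType) (n : nat).
Local Notation S := {mpoly K[n]}.

Lemma submod_val_sum (J : ideal S) (b : nat) (v : 'rV[S]_b) (e : 'I_b -> submod J) :
  submod_val (\sum_j v 0 j *: e j) = \sum_j v 0 j * submod_val (e j).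
Proof. by rewrite (big_morph (@submod_val _ _ J) (id1 := 0) (op1 := +%R)). Qed.

Local Notation var := (fun i : 'I_n => 'X_i : S).

Lemma word_mon_var w : word_mon var w = 'X_[w].
Proof. by rewrite /word_mon -mpolyXE_id. Qed.

Theorem mset_linear_resolution (J : ideal S) M d : ideal_of_mset J M ->
    mset_borel M -> mset_gen M d ->
  has_linear_resolution (@poly_gr K n) (@ideal_gr K n J).
Proof.
move=> JM bM gM.
pose T := [set u : 'X_{1..n < d.+1} | `[< M u >] && (mdeg u == d)]%SET.
pose u (j : 'I_#|T|) : 'X_{1..n} := enum_val j.
have uP j : M (u j) /\ mdeg (u j) = d.
  by have := enum_valP j; rewrite inE => /andP [/asboolP ? /eqP].
have u_inj j j' : u j = u j' -> j = j' by move=> e; apply/enum_val_inj/val_inj.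
have uE p : M p -> mdeg p = d -> exists j, u j = p.
  move=> Mp dp; have lt : (mdeg p < d.+1)%N by rewrite dp.
  have pT : BMultinom lt \in T by rewrite inE /= dp eqxx andbT; apply/asboolP.
  by exists (enum_rank_in pT (BMultinom lt)); rewrite /u enum_rankK_in.
have uJ j : 'X_[u j] \in J by apply/(ideal_of_msetX _ JM); case: (uP j).
pose e j : submod J := Submod (uJ j).
pose aug (v : 'rV[S]_#|T|) := \sum_j v 0 j * 'X_[u j].
have augE (v : 'rV[S]_#|T|) : submod_val (\sum_j v 0 j *: e j) = aug v by rewrite submod_val_sum.
have augt j w : aug (vterm var j w) = 'X_[w + u j].
  rewrite /aug (bigD1 j) //= big1 ?addr0 => [|j' ne]; last first.
    by rewrite !mxE eqxx (negbTE ne) mulr0 mul0r.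
  by rewrite !mxE !eqxx mulr1 word_mon_var mpolyXD.
have augD (v v' : 'rV[S]_#|T|) : aug (v + v') = aug v + aug v'.
  by rewrite /aug -big_split /=; apply: eq_bigr => j _; rewrite mxE mulrDl.
have augZ (a : S) (v : 'rV[S]_#|T|) : aug (a *: v) = a * aug v.
  by rewrite /aug mulr_sumr; apply: eq_bigr => j _; rewrite mxE mulrA.
(* Letters get weight zero, and the order comes from the sum of the indices of [u j], which a Borel
   move lowers. As in the Eliahou-Kervaire resolution, [lnn j] holds the variables before the last
   variable of [u j]. *)
pose L : layer S n := @Layer K S n #|T| 1 (fun j => word_wt (@nat_of_ord n) (u j))
  (fun j => [set i : 'I_n | [exists k : 'I_n, (i < k)%N && (0 < u j k)%N]]%SET)
  (fun v => aug v = 0).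
pose cf (a : S) w := a@_w.
have cf_lin w c (a b : S) : cf (c *: a + b) w = c * cf a w + cf b w.
  by rewrite /cf mcoeffD mcoeffZ.
have cf_mon w v : word_std (fun _ _ : 'I_n => true) w -> cf (word_mon var w) v = (w == v)%:R.
  by rewrite word_mon_var /cf mcoeffX.
have all_std w : word_std (fun _ _ : 'I_n => true) w by apply/word_stdP.
have wt0 w : word_wt (fun _ : 'I_n => 0%N) w = 0%N.
  by rewrite /word_wt big1 // => i _; rewrite muln0.
have span (a : S) : exists r : seq (K * 'X_{1..n}),
    (forall p, p \in r -> word_std (fun _ _ : 'I_n => true) p.2) /\
    a = \sum_(p <- r) p.1 *: word_mon var p.2.
  exists [seq (a@_w, w) | w <- msupp a]; split=> //.
  by rewrite big_map {1}[a]mpolyE; apply: eq_bigr => w _; rewrite word_mon_var.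
have nf w : exists v, [/\ word_std (fun _ _ : 'I_n => true) v, mdeg v = mdeg w,
    word_mon var v = word_mon var w, (word_wt (fun _ : 'I_n => 0) v <= word_wt (fun _ : 'I_n => 0) w)%N &
    ~~ word_std (fun _ _ : 'I_n => true) w ->
       (word_wt (fun _ : 'I_n => 0) v < word_wt (fun _ : 'I_n => 0) w)%N].
  by exists w; split; rewrite ?all_std.
have okL : layer_ok var (fun _ => 0%N) cf L.
  split=> //.
  - by rewrite /= /aug big1 // => j _; rewrite mxE mul0r.
  - by move=> f g; rewrite /= augD => -> ->; rewrite addr0.
  - by move=> a f; rewrite /= augZ => ->; rewrite mulr0.
  - move=> j i; rewrite inE => /existsP [k /andP [ik uk]].
    have [Muj dj] := uP j.
    (* The relation led by [x_i e_j] expresses [x_i u_j = x_k u_j'], where [u_j'] arises from [u_j]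
       by the Borel move from [k] to [i]. *)
    have [j' ej'] : exists j', u j' = (u j - U_(k) + U_(i))%MM.
      apply: uE; first exact: bM.
      by rewrite mdegD mdeg1 -dj -[in RHS](@submK _ U_(k)%MM (u j)) ?lep1mP -?lt0n // mdegD mdeg1.
    exists (vterm var j U_(i) - vterm var j' U_(k)); split.
    + rewrite /= -scaleN1r augD [aug (-1 *: _)]augZ !augt ej' mulN1r; apply/eqP; rewrite subr_eq0; apply/eqP.
      by congr 'X_[_]; rewrite addmA [(U_(k) + _)%MM]addmC submK ?lep1mP -?lt0n // addmC.
    + by apply: (vsuppB cf_lin); apply: (vsupp_term cf_lin cf_mon); rewrite ?mdeg1 ?all_std.
    + rewrite addrAC subrr sub0r -sub0r; apply: (vsuppB cf_lin); first exact: (vsupp0 cf_lin).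
      apply: (vsupp_term cf_lin cf_mon); first exact: all_std.
      rewrite /lkey !wt0 !muln0 !add0n /= ej' word_wtD word_wt1.
      rewrite -[X in (_ < word_wt _ X)%N](@submK _ U_(k)%MM (u j)) ?lep1mP -?lt0n //.
      by rewrite word_wtD word_wt1 ltn_add2l.
  - move=> f kf nf'; apply/rowP => j; rewrite [RHS]mxE; apply/mpolyP => w.
    rewrite mcoeff0; apply/eqP/negP => /negP nz.
    have nw := nf' j w nz.
    have norm (j' : 'I_#|T|) (v : 'X_{1..n}) : @lnormal K S n L j' v ->
        forall i k : 'I_n, (i < k)%N -> (0 < u j' k)%N -> v i = 0%N.
      move=> nv i k ik uk; apply: nv; rewrite inE; apply/existsP; exists k.
      by rewrite ik.
    suff e1 : (aug f)@_(w + u j) = (f 0 j)@_w by rewrite -e1 kf mcoeff0 eqxx in nz.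
    apply: (vsupp_ind cf_lin cf_mon span (Q := fun h => (aug h)@_(w + u j) = (h 0 j)@_w) _ _ _ _ nf').
    + by rewrite -(scale0r 0) augZ mul0r !mxE mul0r !mcoeff0.
    + by move=> g h eg eh; rewrite augD mxE !mcoeffD eg eh.
    + by move=> c h eh; rewrite augZ mxE !mulr_algl !mcoeffZ eh.
    move=> j' v _ nv; rewrite augt !mxE eqxx /= mcoeffX word_mon_var.
    case: (eqVneq j j') => [<-|ne]; first by rewrite mulr1 mcoeffX eqm_add2r.
    rewrite mulr0 mcoeff0; case: eqP => // e1; case/eqP: ne; apply: u_inj.
    have [_ dj] := uP j; have [_ dj'] := uP j'.
    by have [] := stable_factor_unique (etrans dj (esym dj')) (esym e1) (norm _ _ nw) (norm _ _ nv).
apply: (@layer_linear_resolution K S n var (fun _ => 0%N) (fun _ _ => true) cf _ cf_lin cf_mon span nf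
  _ _ _ L e d okL) => //.
- by move=> j; rewrite /ideal_gr /poly_gr /= dhomogX; apply/eqP; case: (uP j).
- by move=> a Ha; apply/dhomogP => w; rewrite mcoeff_msupp; apply: Ha.
- move=> x; suff [v ev] : exists v, aug v = submod_val x.
    by exists v; apply: val_inj; rewrite /= augE.
  have /JM Mx := submod_valP x; rewrite [submod_val x]mpolyE big_seq.
  apply: (big_ind (fun f => exists v, aug v = f)) => [|f g [v <-] [v' <-]|p].
  + by exists 0; rewrite -(scale0r 0) augZ mul0r.
  + by exists (v + v'); rewrite augD.
  rewrite mcoeff_msupp => /Mx /gM [q [Mq le dq]]; have [j ej] := uE q Mq dq.
  exists (((submod_val x)@_p)%:MP *: vterm var j (p - q)%MM).
  by rewrite augZ augt ej submK // mul_mpolyC.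
- move=> v; rewrite /= -augE; split=> [H|->] //; exact: val_inj.
Qed.

End StronglyStableResolution.
(** * Words of pairs in two staircases *)

Section PairWords.
Local Open Scope nat_scope.

Variables (n a1 c1 d1 b1 a2 c2 d2 b2 : nat).
Hypotheses (le_ac1 : (a1 <= c1)) (le_cd1 : (c1 <= d1)) (le_db1 : (d1 <= b1)).
Hypotheses (le_ac2 : (a2 <= c2)) (le_cd2 : (c2 <= d2)) (le_db2 : (d2 <= b2)).
Hypotheses (le_b1n : (b1 <= n)) (le_b2n : (b2 <= n)).
Hypothesis le_c1d2 : (c1 <= d2).

(* A letter [(t, (lo, hi))] has tag [t] and fills its slots with the indices [lo]
   and [hi].  Tag 0 is a variable [x_lo] (with the dummy [hi = 0]), tags 1 and 2
   are a corner pair ([d1 < hi <= b1]) and another pair of the first staircase,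
   tags 3 and 4 the same for the second one.  The kinds of slots are numbered by
   increasing priority. *)
Definition letter := (nat * (nat * nat))%type.
Implicit Types (x y : letter) (w : seq letter) (e : nat * nat).

Definition lo_class (t : nat) : nat := nth 0 [:: 1; 4; 8; 6; 3] t.
Definition hi_class (t : nat) : nat := nth 0 [:: 0; 5; 7; 9; 2] t.
Definition slot_cap (s : nat) : nat :=
  nth 0 [:: 0; n; d2; c2; a1; b1; a2; d1; c1; b2] s.

Definition slots x : seq (nat * nat) :=
  if x.1 == 0 then [:: (1, x.2.1)]
  else [:: (lo_class x.1, x.2.1); (hi_class x.1, x.2.2)].

Definition letter_ok x : bool :=
  (x.1 < 5) && all (fun e => e.2 <= slot_cap e.1) (slots x).

(** One letter for each content: a corner tag is allowed only if the high index does not fit the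
    other tag, and the other pairs are sorted. *)
Definition canonical x : bool :=
  letter_ok x && nth false
    [:: x.2.2 == 0; (d1 < x.2.2); (x.2.1 <= x.2.2); (d2 < x.2.2);
        (x.2.1 <= x.2.2)] x.1.

Definition letter_type x : nat := nth 0 [:: 0; 1; 1; 2; 2] x.1.
Definition word_slots w : seq (nat * nat) := flatten (map slots w).
Definition word_vars w : seq nat := map snd (word_slots w).
(** Types, unlike tags, do not tell corner letters from other pairs, so this is equality of the
    products in the variables [x] and [t]. *)
Definition same_content w w' : bool :=
  perm_eq (word_vars w) (word_vars w') &&
  perm_eq (map letter_type w) (map letter_type w').

(* [letter_wt] encodes the lexicographic order of the sums over two letters of
   the next three weights. *)
Definition tag_wt x : nat := (3 * (x.1 == 3) + (x.1 == 1)).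
(** By rearrangement, the sum is least when small indices occupy the classes with large numbers. *)
Definition slot_wt x : nat := (lo_class x.1 * x.2.1 + hi_class x.1 * x.2.2).
(** For two letters the sum of the products of low and high index is largest when both are sorted
    alike; the subtraction makes this a minimum. *)
Definition pair_wt x : nat := if x.1 == 0 then 0 else (n * n - x.2.1 * x.2.2).
Definition letter_wt x : nat :=
  ((tag_wt x * (32 * n).+1 + slot_wt x) * (2 * (n * n)).+1 + pair_wt x).

Definition good_pair x y : Prop := forall x' y', letter_ok x' -> letter_ok y' ->
  same_content [:: x; y] [:: x'; y'] ->
  (letter_wt x + letter_wt y <= letter_wt x' + letter_wt y').

Lemma letter_okP x : letter_ok x -> [\/ [/\ x.1 = 0 & (x.2.1 <= n)],
  [/\ x.1 = 1, (x.2.1 <= a1) & (x.2.2 <= b1)],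
  [/\ x.1 = 2, (x.2.1 <= c1) & (x.2.2 <= d1)] |
  [/\ x.1 = 3, (x.2.1 <= a2) & (x.2.2 <= b2)] \/
  [/\ x.1 = 4, (x.2.1 <= c2) & (x.2.2 <= d2)]].
Proof.
case: x => t [l h]; rewrite /letter_ok /slots /=.
case: t => [|[|[|[|[|//]]]]] /=; rewrite ?andbT /slot_cap /=.
- by move=> ?; constructor 1.
- by case/andP; constructor 2.
- by case/andP; constructor 3.
- by case/andP; constructor 4; left.
- by case/andP; constructor 4; right.
Qed.

Lemma slot_wt_bound x : letter_ok x -> (slot_wt x <= 16 * n).
Proof.
case: x => t [l h] /letter_okP /= [[/= -> ?]|[/= -> ? ?]|[/= -> ? ?]|[[/= -> ? ?]|[/= -> ? ?]]];
rewrite /slot_wt /lo_class /hi_class /=; lia.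
Qed.

Lemma pair_wt_bound x : (pair_wt x <= n * n).
Proof. by rewrite /pair_wt; case: ifP => _ //; apply: leq_subr. Qed.

(** Over two letters the slot weights total at most [32 * n] and the pair weights at most
    [2 * (n * n)], each below its base, so no carry occurs. The factor 3 in [tag_wt] likewise
    exceeds the at most two letters of tag 1. *)
Lemma letter_wt_lt x y x' y' : letter_ok x -> letter_ok y -> letter_ok x' -> letter_ok y' ->
    ((tag_wt x' + tag_wt y' < tag_wt x + tag_wt y) \/
     (tag_wt x' + tag_wt y' = tag_wt x + tag_wt y) /\
     ((slot_wt x' + slot_wt y' < slot_wt x + slot_wt y) \/
      (slot_wt x' + slot_wt y' = slot_wt x + slot_wt y) /\
      (pair_wt x' + pair_wt y' < pair_wt x + pair_wt y))) ->
  (letter_wt x' + letter_wt y' < letter_wt x + letter_wt y).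
Proof.
move=> /slot_wt_bound bx /slot_wt_bound b_y /slot_wt_bound bx' /slot_wt_bound b_y'.
have := pair_wt_bound x; have := pair_wt_bound y.
have := pair_wt_bound x'; have := pair_wt_bound y'.
rewrite /letter_wt; move: bx b_y bx' b_y'.
move: (tag_wt x) (tag_wt y) (tag_wt x') (tag_wt y') => t1 t2 t3 t4.
move: (slot_wt x) (slot_wt y) (slot_wt x') (slot_wt y') => s1 s2 s3 s4.
move: (pair_wt x) (pair_wt y) (pair_wt x') (pair_wt y') => p1 p2 p3 p4.
move: (n * n) => nn ? ? ? ? ? ? ? ? H.
have lex (T T' B r r' : nat) : (r' < B) -> (T' < T) -> (T' * B + r' < T * B + r).
  by move=> *; nia.
rewrite addnACA -mulnDl [ltnRHS]addnACA -mulnDl.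
case: H => [lt|[e H]].
  apply: (lex); first lia.
  by rewrite addnACA -mulnDl [ltnRHS]addnACA -mulnDl; apply: (lex) => //; lia.
case: H => [lt|[e' lt]].
  by apply: (lex); first lia; rewrite addnACA -mulnDl [ltnRHS]addnACA -mulnDl e ltn_add2l.
by rewrite addnACA -mulnDl e [X in (_ < X * _ + _)]addnACA -mulnDl e' ltn_add2l.
Qed.

Lemma same_content_refl w : same_content w w.
Proof. by rewrite /same_content !perm_refl. Qed.

Lemma swap_content t l h : t \in [:: 2; 4] ->
  same_content [:: (t, (l, h))] [:: (t, (h, l))].
Proof.
move=> tt.
have vE u v : word_vars [:: (t, (u, v))] = [:: u; v].
  by move: tt; rewrite !inE => /orP [] /eqP ->.
rewrite /same_content perm_refl andbT !vE.
by rewrite -cat1s -[in X in perm_eq _ X]cat1s perm_catC.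
Qed.

Lemma retag_content t l h : t \in [:: 1; 3] ->
  same_content [:: (t, (l, h))] [:: (t.+1, (l, h))].
Proof. by rewrite !inE => /orP [] /eqP ->; rewrite /same_content perm_refl. Qed.

Lemma same_content_trans w w' w'' :
  same_content w w' -> same_content w' w'' -> same_content w w''.
Proof.
move=> /andP [p q] /andP [p' q']; apply/andP; split; exact: perm_trans p' || exact: perm_trans q'.
Qed.

(** Retagging a corner letter whose high index fits the other tag lowers the tag weight, and sorting
    a pair lowers the slot weight. Minimality among canonical letters is thus minimality among all
    valid ones. *)
Lemma letter_wt_le_canonical x : letter_ok x -> exists y, [/\ canonical y,
  same_content [:: x] [:: y] & (letter_wt y <= letter_wt x)].
Proof.
have wtB t l h t' l' h' : (tag_wt (t', (l', h')) <= tag_wt (t, (l, h))) ->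
    (slot_wt (t', (l', h')) <= slot_wt (t, (l, h))) ->
    pair_wt (t', (l', h')) = pair_wt (t, (l, h)) ->
    (letter_wt (t', (l', h')) <= letter_wt (t, (l, h))).
  move=> ? ? e; rewrite /letter_wt e leq_add2r leq_mul2r; apply/orP; right.
  by apply: leq_add => //; rewrite leq_mul2r; apply/orP; right.
have even t l h : t \in [:: 2; 4] -> letter_ok (t, (l, h)) -> exists y, [/\ canonical y,
    same_content [:: (t, (l, h))] [:: y] & (letter_wt y <= letter_wt (t, (l, h)))].
  move=> tt ok; case: (leqP l h) => [le|lt].
    exists (t, (l, h)); rewrite same_content_refl leqnn /canonical ok /=; split=> //.
    by move: tt; rewrite !inE => /orP [] /eqP ->.
  exists (t, (h, l)); split; last 1 first.
  - apply: wtB => //; last by rewrite /pair_wt /= mulnC.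
    move: tt; rewrite !inE => /orP [] /eqP ->; rewrite /slot_wt /lo_class /hi_class /=; lia.
  - move: tt ok; rewrite !inE => /orP [] /eqP -> /letter_okP /=
      [[]|[]|[]|[[]|[]]] // _ ? ?; rewrite /canonical /letter_ok /= /slots /= /slot_cap /=; lia.
  - exact: swap_content.
case: x => t [l h] ok; move: (ok) => /letter_okP /= [[e ?]|[e ? ?]|[e ? ?]|[[e ? ?]|[e ? ?]]].
- exists (0, (l, 0)); rewrite e; split=> //.
  + by move: ok; rewrite e /canonical /= andbT.
  + by rewrite /same_content perm_refl.
- case: (ltnP d1 h) => [lt|le].
    by exists (t, (l, h)); rewrite same_content_refl leqnn /canonical ok e /= lt.
  have ok' : letter_ok (2, (l, h)).
    by rewrite /letter_ok /= /slots /= /slot_cap /=; lia.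
  have [y [cy sy wy]] := even 2 l h isT ok'.
  exists y; split=> //; first by rewrite e; apply: same_content_trans sy; apply: retag_content.
  apply: leq_trans wy _; rewrite e in ok *.
  by have := letter_wt_lt ok ok ok' ok' (or_introl isT); rewrite !addnn ltn_double => /ltnW.
- by apply: even => //; rewrite e.
- case: (ltnP d2 h) => [lt|le].
    by exists (t, (l, h)); rewrite same_content_refl leqnn /canonical ok e /= lt.
  have ok' : letter_ok (4, (l, h)).
    by rewrite /letter_ok /= /slots /= /slot_cap /=; lia.
  have [y [cy sy wy]] := even 4 l h isT ok'.
  exists y; split=> //; first by rewrite e; apply: same_content_trans sy; apply: retag_content.
  apply: leq_trans wy _; rewrite e in ok *.
  by have := letter_wt_lt ok ok ok' ok' (or_introl isT); rewrite !addnn ltn_double => /ltnW.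
- by apply: even => //; rewrite e.
Qed.

(** * Exchanges of indices in good words *)

Definition good_word w : Prop := all canonical w /\
  forall x y, x \in w -> y \in w -> x != y -> good_pair x y.

(* Exchanging indices between two slots cannot give the slot of higher priority
   a smaller one. *)
Definition stable (s : seq (nat * nat)) : Prop :=
  forall e e', e \in s -> e' \in s -> e'.1 < e.1 -> e.2 <= e'.2 \/ slot_cap e'.1 < e.2.

Lemma canonical_ok x : canonical x -> letter_ok x.
Proof. by case/andP. Qed.

Lemma perm4 (T : eqType) (a b c d : T) :
  [/\ perm_eq [:: a; b; c; d] [:: c; b; a; d], perm_eq [:: a; b; c; d] [:: a; d; c; b] &
      perm_eq [:: a; b; c; d] [:: a; c; b; d]].
Proof.
by split; apply/permP => p /=; move: (p a : nat) (p b : nat) (p c : nat) (p d : nat);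
  clear; lia.
Qed.

Lemma improve x y x' y' : good_pair x y -> canonical x -> canonical y ->
    letter_ok x' -> letter_ok y' ->
    same_content [:: x; y] [:: x'; y'] ->
    ~ ((tag_wt x' + tag_wt y' < tag_wt x + tag_wt y) \/
     (tag_wt x' + tag_wt y' = tag_wt x + tag_wt y) /\
     ((slot_wt x' + slot_wt y' < slot_wt x + slot_wt y) \/
      (slot_wt x' + slot_wt y' = slot_wt x + slot_wt y) /\
      (pair_wt x' + pair_wt y' < pair_wt x + pair_wt y))).
Proof.
move=> good /canonical_ok ox /canonical_ok oy ox' oy' sc H.
have := good x' y' ox' oy' sc; rewrite leqNgt => /negP; apply.
exact: letter_wt_lt.
Qed.

Definition set_slot (b : bool) x v : letter :=
  if b then (x.1, (x.2.1, v)) else (x.1, (v, x.2.2)).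

Definition slot_at (b : bool) x : nat * nat :=
  if b then (hi_class x.1, x.2.2) else (lo_class x.1, x.2.1).

Lemma mem_slots e x : e \in slots x -> exists2 b, (b ==> (x.1 != 0)) & e = slot_at b x.
Proof.
rewrite /slots; case: (eqVneq x.1 0) => [e0|ne].
  by rewrite inE => /eqP ->; exists false; rewrite // /slot_at e0.
rewrite !inE => /orP [] /eqP ->; [by exists false | by exists true; rewrite // ?ne].
Qed.

Lemma letter_ok_slot b x v : letter_ok x -> v <= slot_cap (slot_at b x).1 ->
  (b ==> (x.1 != 0)) -> letter_ok (set_slot b x v).
Proof.
case: x b => t [l h] [] /andP [/= t5 ok] hv; rewrite /letter_ok /= t5 /=.
  move=> t0; move: ok hv; rewrite /slots /slot_at /= (negbTE t0) /= !andbT.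
  by case/andP => -> _ ->.
move=> _; move: ok hv; rewrite /slots /slot_at /=; case: eqP => [->|_] /=.
  by rewrite /lo_class /= !andbT.
by rewrite !andbT => /andP [_ ->] ->.
Qed.

Lemma set_slot_content b b' x y u v :
    (slot_at b x).2 = u -> (slot_at b' y).2 = v ->
    (b ==> (x.1 != 0)) -> (b' ==> (y.1 != 0)) ->
  same_content [:: x; y] [:: set_slot b x v; set_slot b' y u].
Proof.
move=> eu ev bx b_y; apply/andP; split; last first.
  by case: b b' {eu ev bx b_y} => [] []; rewrite perm_refl.
apply/permP => p; rewrite /word_vars /word_slots /= !cats0 !map_cat !count_cat.
move: eu ev bx b_y; case: x y => t [l h] [t' [l' h']].
rewrite /slots /slot_at /set_slot.
by case: b b' => [] [] /= <- <-; case: eqP => //= _; case: eqP => //= _ _ _; lia.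
Qed.

Lemma set_slot_wt b x v : (b ==> (x.1 != 0)) ->
  slot_wt (set_slot b x v) + (slot_at b x).1 * (slot_at b x).2 =
  slot_wt x + (slot_at b x).1 * v.
Proof. by case: x b => t [l h] [] _; rewrite /slot_wt /set_slot /slot_at /=; lia. Qed.

Lemma set_slot_tag b x v : (set_slot b x v).1 = x.1.
Proof. by case: b. Qed.

(** In a corner letter the high index exceeds the capacity of the low slot. In the other pairs the
    low slot has the higher priority and the smaller index. *)
Lemma canonical_stable x : canonical x -> stable (slots x).
Proof.
case/andP => /letter_okP H can e e'; case: x H can => t [l h] /=.
case=> [[/= -> ?]|[/= -> ? ?]|[/= -> ? ?]|[[/= -> ? ?]|[/= -> ? ?]]];
  rewrite /slots /lo_class /hi_class /= !inE => H.
- by move=> /eqP -> /eqP ->.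
all: move=> /orP [] /eqP -> /orP [] /eqP -> //=; rewrite /slot_cap /=; lia.
Qed.

Lemma mem_word_slots w e : reflect (exists2 x, x \in w & e \in slots x) (e \in word_slots w).
Proof. exact: flatten_mapP. Qed.

Lemma canonical_slot_cap x e : letter_ok x -> e \in slots x -> e.2 <= slot_cap e.1.
Proof. by case/andP => _ /allP H /H. Qed.

(** Between two letters, a forbidden configuration could be exchanged, keeping the tags and lowering
    the slot weight. *)
Lemma good_word_stable w : good_word w -> stable (word_slots w).
Proof.
move=> [/allP can good] e e' /mem_word_slots [x xw ex] /mem_word_slots [x' x'w ex'] lt.
case: (eqVneq x x') => [exx|ne].
  by apply: (canonical_stable (can _ xw)) lt => //; rewrite exx.
case: (leqP e.2 e'.2) => [?|lt2]; first by left.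
case: (ltnP (slot_cap e'.1) e.2) => [?|le]; [by right | exfalso].
have cap := canonical_slot_cap (canonical_ok (can _ xw)) ex.
have [b bx eb] := mem_slots ex; have [b' bx' eb'] := mem_slots ex'.
apply: (improve (good _ _ xw x'w ne) (can _ xw) (can _ x'w)
  (x' := set_slot b x e'.2) (y' := set_slot b' x' e.2)).
- apply: letter_ok_slot => //; first exact/canonical_ok/can.
  by rewrite -eb; apply: leq_trans cap; apply: ltnW.
- by apply: letter_ok_slot => //; [exact/canonical_ok/can | rewrite -eb'].
- by apply: set_slot_content; rewrite // -?eb -?eb'.
right; split; first by rewrite /tag_wt !set_slot_tag.
left; have := set_slot_wt e'.2 bx; have := set_slot_wt e.2 bx'.
rewrite -eb -eb'; nia.
Qed.

(** Exchanging the high indices of two letters with the same tag keeps the slot weight, and would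
    lower the pair weight of an unsorted pair. *)
Lemma good_word_cosorted w x y : good_word w -> x \in w -> y \in w ->
  x.1 = y.1 -> x.1 != 0 -> x.2.1 < y.2.1 -> x.2.2 <= y.2.2.
Proof.
move=> [/allP can good] xw yw exy x0 lt; rewrite leqNgt; apply/negP => lt2.
have ne : x != y by apply: contraTneq lt => ->; rewrite ltnn.
have := can _ xw; have := can _ yw; have := good _ _ xw yw ne.
case: x y exy x0 lt lt2 {xw yw ne} => t [l h] [t' [l' h']] /= <- t0 lt lt2 gd cy cx.
apply: (improve gd cx cy (x' := (t, (l, h'))) (y' := (t, (l', h)))).
- have := canonical_ok cx; have := canonical_ok cy.
  by rewrite /letter_ok /slots /= (negbTE t0) /= => /and4P [-> _ -> _] /and4P [_ -> _ _].
- have := canonical_ok cx; have := canonical_ok cy.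
  by rewrite /letter_ok /slots /= (negbTE t0) /= => /and4P [-> -> _ _] /and4P [_ _ -> _].
- apply/andP; split; last by rewrite perm_refl.
  rewrite /word_vars /word_slots /slots /= (negbTE t0) /=.
  by have [_ + _] := perm4 l h l' h'.
right; split; first by [].
right; split; first by rewrite /slot_wt /=; lia.
have bound (c : letter) : canonical c -> c.1 != 0 -> c.2.1 <= n /\ c.2.2 <= n.
  by move=> /canonical_ok /letter_okP [[->]|[-> ? ?]|[-> ? ?]|[[-> ? ?]|[-> ? ?]]] // _; lia.
have [? ?] := bound _ cx t0; have [? ?] := bound _ cy t0.
rewrite /pair_wt /= (negbTE t0); simpl in *; nia.
Qed.


Lemma seq_argmin (T : eqType) (P : pred T) (f : T -> nat) (s : seq T) :
  has P s -> exists z : T, [/\ z \in s, P z & forall u, u \in s -> P u -> f z <= f u].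
Proof.
elim: s => //= z s IH; case: (boolP (has P s)) => [/IH [u [us Pu umin]] _|nP].
  case: (boolP (P z && (f z <= f u))) => [/andP [Pz le]|H].
    exists z; split=> //; first by rewrite mem_head.
    move=> v; rewrite inE => /orP [/eqP -> //|vs Pv].
    exact: leq_trans le (umin _ vs Pv).
  exists u; split=> //; first by rewrite inE us orbT.
  move=> v; rewrite inE => /orP [/eqP -> Pz|]; last exact: umin.
  by move: H; rewrite Pz /= -ltnNge => /ltnW.
rewrite orbF => Pz; exists z; split=> //; first by rewrite mem_head.
move=> v; rewrite inE => /orP [/eqP -> //|vs Pv].
by case/negP: nP; apply/hasP; exists v.
Qed.

Lemma letter_argmin (P : pred letter) (f : letter -> nat) (s : seq letter) :
  has P s -> exists z : letter, [/\ z \in s, P z & forall u, u \in s -> P u -> f z <= f u].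
Proof. exact: seq_argmin. Qed.

Lemma seq_max (s : seq nat) : 0 < size s ->
  exists2 m, m \in s & forall v, v \in s -> v <= m.
Proof.
elim: s => // u [|u' s] IH _; first by exists u; rewrite ?inE // => v; rewrite inE => /eqP ->.
have [//|m ms mmax] := IH; exists (maxn u m).
  by case: (leqP u m) => _; rewrite inE ?ms ?eqxx ?orbT.
by move=> v; rewrite inE leq_max => /orP [/eqP ->|/mmax ->]; rewrite ?leqnn ?orbT.
Qed.

(** * Counting slots against indices *)

Definition tag_count t w : nat := count (fun x => x.1 == t) w.

(* The number of slots of capacity at most [k]; a word of valid letters has at
   least as many values at most [k]. *)
Definition cap_count k w : nat := count (fun e => slot_cap e.1 <= k) (word_slots w).
Definition var_count k w : nat := count (fun e => e.2 <= k) (word_slots w).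

Lemma cap_countE k w : all letter_ok w -> cap_count k w =
  tag_count 0 w * (n <= k) + tag_count 1 w * ((a1 <= k) + (b1 <= k)) +
  tag_count 2 w * ((c1 <= k) + (d1 <= k)) +
  tag_count 3 w * ((a2 <= k) + (b2 <= k)) +
  tag_count 4 w * ((c2 <= k) + (d2 <= k)).
Proof.
elim: w => //= x w IH /andP [/letter_okP ox /IH {}IH].
rewrite /cap_count /word_slots /= count_cat -/(word_slots w) -/(cap_count k w) IH.
rewrite /tag_count /= /slots.
by case: ox => [[->]|[->]|[->]|[[->]|[->]]] * /=; rewrite /slot_cap /=; lia.
Qed.

Lemma sub_in_count (T : eqType) (p q : pred T) (s : seq T) :
  {in s, forall z, p z -> q z} -> count p s <= count q s.
Proof.
move=> pq; rewrite (@eq_in_count _ p (predI p q)) => [|z /pq /=].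
  by apply: sub_count => z /andP [].
by case: (p z) => //= ->.
Qed.

Lemma cap_le_var_count k w : all letter_ok w -> cap_count k w <= var_count k w.
Proof.
move=> /allP ok; apply: sub_in_count => e /mem_word_slots [x /ok ox ex].
exact: leq_trans (canonical_slot_cap ox ex).
Qed.

(** Otherwise every index at most [k] would sit in a slot of capacity at most [k]. *)
Lemma slack_slot k w : cap_count k w < var_count k w ->
  exists2 e, e \in word_slots w & e.2 <= k < slot_cap e.1.
Proof.
move=> lt; apply/hasP; apply: contraLR lt => /hasPn H.
rewrite -leqNgt; apply: sub_in_count => e es le.
by have := H _ es; rewrite le /= -leqNgt.
Qed.

Lemma var_count_content k w w' :
  same_content w w' -> var_count k w = var_count k w'.
Proof.
case/andP => /permP /(_ (fun v => v <= k)); rewrite !count_map.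
by move=> e _; exact: e.
Qed.

Lemma type_count w : all letter_ok w ->
  [/\ count (fun t => t == 0) (map letter_type w) = tag_count 0 w,
      count (fun t => t == 1) (map letter_type w) = tag_count 1 w + tag_count 2 w &
      count (fun t => t == 2) (map letter_type w) = tag_count 3 w + tag_count 4 w].
Proof.
elim: w => //= x w IH /andP [/letter_okP ox /IH [-> -> ->]].
by rewrite /tag_count /= /letter_type; case: ox => [[->]|[->]|[->]|[[->]|[->]]] * /=; split; lia.
Qed.

Lemma same_content_type w w' : all letter_ok w -> all letter_ok w' -> same_content w w' ->
  [/\ tag_count 0 w = tag_count 0 w',
      tag_count 1 w + tag_count 2 w = tag_count 1 w' + tag_count 2 w' &
      tag_count 3 w + tag_count 4 w = tag_count 3 w' + tag_count 4 w'].
Proof.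
move=> /type_count [<- <- <-] /type_count [<- <- <-] /andP [_ /permP H].
by split; apply: H.
Qed.

(** Letters with the same tag are cosorted, so one with the least sum of indices is least in both
    components. *)
Lemma min_letter w t : good_word w -> 0 < tag_count t w -> t != 0 ->
  exists x : letter, [/\ x \in w, x.1 = t &
    forall y, y \in w -> y.1 = t -> x.2.1 <= y.2.1 /\ x.2.2 <= y.2.2].
Proof.
move=> gw; rewrite -has_count => /(letter_argmin (fun x => x.2.1 + x.2.2)).
case=> x [xw /eqP xt xmin] t0; exists x; split=> // y yw yt.
have le := xmin y yw; rewrite yt eqxx in le; have {}le := le isT.
have x0 : x.1 != 0 by rewrite xt.
have y0 : y.1 != 0 by rewrite yt.
case: (ltngtP x.2.1 y.2.1) => [lt|gt|eq].
- split; first by lia.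
  by apply: (good_word_cosorted gw) lt; rewrite ?xt ?yt.
- by have := good_word_cosorted gw yw xw (etrans yt (esym xt)) y0 gt; split; lia.
- by lia.
Qed.

Lemma prior_slot w e : all letter_ok w -> e \in word_slots w -> 4 < e.1 ->
  exists2 x : letter, x \in w &
    [\/ x.1 = 2 /\ e = (8, x.2.1), x.1 = 2 /\ e = (7, x.2.2),
        x.1 = 3 /\ e = (9, x.2.2) |
        x.1 = 3 /\ e = (6, x.2.1) \/ x.1 = 1 /\ e = (5, x.2.2)].
Proof.
move=> /allP ok /mem_word_slots [x xw ex] lt; exists x => //.
have /letter_okP := ok _ xw; case: x ex {xw} => t [l h].
move=> ex; case=> [[/= et _]|[/= et _ _]|[/= et _ _]|[[/= et _ _]|[/= et _ _]]];
  move: ex lt; rewrite et /slots /lo_class /hi_class /= !inE.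
- by move/eqP ->.
- by case/orP=> /eqP -> // _; constructor 4; right.
- by case/orP=> /eqP -> // _; [constructor 1 | constructor 2].
- by case/orP=> /eqP -> // _; [constructor 4; left | constructor 3].
- by case/orP=> /eqP ->.
Qed.

(* In a good word, an index [< z] in a slot of capacity [>= z] could be exchanged
   with [z] unless its slot has higher priority. *)
Lemma slack_prior w s z e : good_word w -> (s, z) \in word_slots w ->
    (forall v, (s, v) \in word_slots w -> z <= v) ->
  e \in word_slots w -> e.2 < z <= slot_cap e.1 -> s < e.1.
Proof.
move=> gw zw zmin ew /andP [lt le].
case: (ltngtP s e.1) => // [gt|eq].
  by have := good_word_stable gw zw ew gt => /= -[]; lia.
by have := zmin e.2; rewrite eq -surjective_pairing => /(_ ew); lia.
Qed.

Lemma slack_content w w' z : all letter_ok w' ->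
    same_content w w' -> 0 < z -> cap_count z.-1 w < cap_count z.-1 w' ->
  exists2 e, e \in word_slots w & e.2 < z <= slot_cap e.1.
Proof.
move=> ok' sc z0 lt.
have [|e ew le] := @slack_slot z.-1 w; last by exists e => //; lia.
by rewrite (var_count_content _ sc); apply: leq_trans lt _; apply: cap_le_var_count.
Qed.

Lemma mem_slot b x w : x \in w -> (b ==> (x.1 != 0)) -> slot_at b x \in word_slots w.
Proof.
move=> xw bx; apply/mem_word_slots; exists x => //; rewrite /slots /slot_at.
case: b bx => /= [/negbTE ->|_]; first by rewrite !inE eqxx orbT.
by case: eqP => [->|_]; rewrite inE eqxx.
Qed.

Lemma good_word_ok w : good_word w -> all letter_ok w.
Proof. by case=> /allP can _; apply/allP => x /can /canonical_ok. Qed.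

Lemma tag_count_lt_mem t w x : x \in w -> x.1 = t -> 0 < tag_count t w.
Proof. by move=> xw xt; rewrite -has_count; apply/hasP; exists x; rewrite ?xt. Qed.

(** By pigeonhole, [w] holds an index below [z] in a slot that could hold [z], and stability gives
    that slot a priority above [s]. Four kinds of slots remain, which the two minimality proofs
    below exclude or exploit. *)
Lemma slack_letter w w' s z : good_word w -> all letter_ok w' -> same_content w w' ->
    4 < s -> 0 < z -> (s, z) \in word_slots w ->
    (forall v, (s, v) \in word_slots w -> z <= v) ->
    cap_count z.-1 w < cap_count z.-1 w' ->
  exists2 x : letter, x \in w &
    [\/ [/\ s < 8, x.1 = 2 & x.2.1 < z <= c1], [/\ s < 7, x.1 = 2 & x.2.2 < z <= d1],
        [/\ s < 9, x.1 = 3 & x.2.2 < z <= b2] | [/\ s < 6, x.1 = 3 & x.2.1 < z <= a2]].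
Proof.
move=> gw ok' sc s4 z0 zw zmin lt; have ok := good_word_ok gw.
have [e ew le] := slack_content ok' sc z0 lt.
have lts := slack_prior gw zw zmin ew le.
have [x xw H] := prior_slot ok ew (ltn_trans s4 lts).
exists x => //; case: H => [[xt ee]|[xt ee]|[xt ee]|[[xt ee]|[xt ee]]];
  rewrite ee /slot_cap /= in lts le.
- by constructor 1.
- by constructor 2.
- by constructor 3.
- by constructor 4.
- by lia.
Qed.

(** With too many letters of tag 3, counting capacities below the least high index [z2] yields a
    letter of tag 2. Trading the least letters of tags 3 and 2 for letters of tags 1 and 4 would
    lower the tag weight. The condition [c1 <= d2] enters these counts. *)
Lemma good_word_tag3_min w w' : good_word w -> all letter_ok w' -> same_content w w' ->
  tag_count 3 w <= tag_count 3 w'.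
Proof.
move=> gw ok' sc; rewrite leqNgt; apply/negP => lt3.
have ok := good_word_ok gw; have [can good] := gw; move/allP in can.
have [e0 e12 e34] := same_content_type ok ok' sc.
have [x [xw xt xmin]] := min_letter gw (leq_ltn_trans (leq0n _) lt3) isT.
case: x xt xw xmin => t [k2 z2] /= -> xw xmin.
have cx := can _ xw; have /letter_okP := canonical_ok cx.
case=> [[]|[]|[]|[[]|[]]] //= _ k2a z2b.
have z2d : d2 < z2 by move: cx => /andP [].
have min9 v : (9, v) \in word_slots w -> z2 <= v.
  move=> vw; have [y yw] := prior_slot ok vw isT.
  by case=> [[]|[]|[yt [->]]|[[]|[]]] //; case: (xmin y yw yt).
have m9 : (9, z2) \in word_slots w := @mem_slot true _ _ xw isT.
have sl s z := @slack_letter w w' s z gw ok' sc.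
have z0 : 0 < z2 := leq_ltn_trans (leq0n _) z2d.
(* Class 9 has the highest priority, so there is no slack at [z2]. *)
have cap9 : cap_count z2.-1 w' <= cap_count z2.-1 w.
  by rewrite leqNgt; apply/negP => /(sl 9 z2 isT z0 m9 min9) [y _ [[]|[]|[]|[]]].
(* A letter of tag 4 has one more capacity below [z2] than one of tag 3. To compensate, [w'] must
   have more letters of tag 1 in place of tag 2, with [z2] between [d1] and [b1]. *)
have [lt1 z2d1 z2b1] : [/\ tag_count 1 w < tag_count 1 w', d1 < z2 & z2 <= b1].
  move: cap9; rewrite !cap_countE // e0.
  clear -lt3 e12 e34 z0 z2d z2b le_c1d2 le_ac1 le_cd1 le_db1 le_ac2 le_cd2 le_db2.
  have -> : (a2 <= z2.-1) = true by lia.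
  have -> : (c2 <= z2.-1) = true by lia.
  have -> : (d2 <= z2.-1) = true by lia.
  have -> : (b2 <= z2.-1) = false by lia.
  have -> : (a1 <= z2.-1) = true by lia.
  have -> : (c1 <= z2.-1) = true by lia.
  case: (leqP d1 z2.-1) => ?; case: (leqP b1 z2.-1) => ? ?; split; lia.
have [y [yw yt ymin]] : exists y : letter, [/\ y \in w, y.1 = 2 &
    forall u, u \in w -> u.1 = 2 -> y.2.1 <= u.2.1 /\ y.2.2 <= u.2.2].
  by apply: min_letter => //; lia.
case: y yt yw ymin => t' [y m] /= -> yw ymin.
have cy := can _ yw; have /letter_okP := canonical_ok cy.
case=> [[]|[]|[]|[[]|[]]] //= _ yc md.
have ym : y <= m by move: cy => /andP [].
have gd : good_pair (3, (k2, z2)) (2, (y, m)) by apply: good.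
(* The index [m] is to become the high index of a letter of tag 4. *)
have md2 : m <= d2.
  rewrite leqNgt; apply/negP => md2.
  have m7 : (7, m) \in word_slots w := @mem_slot true _ _ yw isT.
  have min7 v : (7, v) \in word_slots w -> m <= v.
    move=> vw; have [u uw] := prior_slot ok vw isT.
    by case=> [[]|[ut [->]]|[]|[[]|[]]] //; case: (ymin u uw ut).
  have m0 : 0 < m := leq_ltn_trans (leq0n _) md2.
  have [] := sl 7 m isT m0 m7 min7; last first.
    move=> u uw [[_ _]|[]|[_ ut]|[]] //; first by clear -md2 le_c1d2; lia.
    by case: (xmin u uw ut) => _; clear -z2d1 md; lia.
  rewrite !cap_countE // e0.
  clear -lt3 e12 e34 md2 md le_c1d2 z2d1 z2b1 z2b le_ac1 le_cd1 le_db1 le_ac2 le_cd2 le_db2.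
  have -> : (a2 <= m.-1) = true by lia.
  have -> : (c2 <= m.-1) = true by lia.
  have -> : (d2 <= m.-1) = true by lia.
  have -> : (b2 <= m.-1) = false by lia.
  have -> : (a1 <= m.-1) = true by lia.
  have -> : (c1 <= m.-1) = true by lia.
  have -> : (d1 <= m.-1) = false by lia.
  have -> : (b1 <= m.-1) = false by lia.
  lia.
have okB4 l h : l <= c2 -> h <= d2 -> letter_ok (4, (l, h)).
  by rewrite /letter_ok /slots /= /slot_cap /= => -> ->.
have okA1 l h : l <= a1 -> h <= b1 -> letter_ok (1, (l, h)).
  by rewrite /letter_ok /slots /= /slot_cap /= => -> ->.
(* The high indices go to tag 1 ([z2]) and tag 4 ([m]). For the low index of the letter of tag 1,
   first [y] is tried and then [k2]. *)
case: (leqP y a1) => ya.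
  apply: (improve gd cx cy (okA1 _ _ ya z2b1) (okB4 _ _ (leq_trans k2a le_ac2) md2)).
    apply/andP; split; last by apply: (@perm_catC _ [:: 2] [:: 1]).
    by have [+ _ _] := perm4 k2 z2 y m.
  by left.
have capy : cap_count y.-1 w < cap_count y.-1 w' \/ a2 < y <= c2.
  rewrite !cap_countE // e0.
  clear -lt1 lt3 e12 e34 ya yc le_c1d2 le_cd1 le_db1 le_db2.
  have -> : (d2 <= y.-1) = false by lia.
  have -> : (b2 <= y.-1) = false by lia.
  have -> : (a1 <= y.-1) = true by lia.
  have -> : (b1 <= y.-1) = false by lia.
  have -> : (c1 <= y.-1) = false by lia.
  have -> : (d1 <= y.-1) = false by lia.
  by case: (leqP a2 y.-1) => ?; case: (leqP c2 y.-1) => ?; lia.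
have /andP [ay yc2] : a2 < y <= c2.
  case: capy => // lt.
  have m8 : (8, y) \in word_slots w := @mem_slot false _ _ yw isT.
  have min8 v : (8, v) \in word_slots w -> y <= v.
    move=> vw; have [u uw] := prior_slot ok vw isT.
    by case=> [[ut [->]]|[]|[]|[[]|[]]] //; case: (ymin u uw ut).
  have y0 : 0 < y := leq_ltn_trans (leq0n _) ya.
  have [u uw] := sl 8 y isT y0 m8 min8 lt.
  by case=> [[]|[]|[_ ut]|[]] //; case: (xmin u uw ut) => _; clear -z2d1 yc le_cd1; lia.
case: (leqP k2 a1) => ka.
  apply: (improve gd cx cy (okA1 _ _ ka z2b1) (okB4 _ _ yc2 md2)); last by left.
  by apply/andP; split; last by apply: (@perm_catC _ [:: 2] [:: 1]).
(* Now [a1 < k2 <= a2 < y], so [a1] is the only capacity below [k2], and [w'] has more slots of it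
   by [lt1]. *)
have m6 : (6, k2) \in word_slots w := @mem_slot false _ _ xw isT.
have min6 v : (6, v) \in word_slots w -> k2 <= v.
  move=> vw; have [u uw] := prior_slot ok vw isT.
  by case=> [[]|[]|[]|[[ut [->]]|[]]] //; case: (xmin u uw ut).
have k0 : 0 < k2 := leq_ltn_trans (leq0n _) ka.
have [] := sl 6 k2 isT k0 m6 min6.
  rewrite !cap_countE // e0.
  clear -lt1 lt3 e12 e34 k0 k2a ka ay yc le_ac1 le_cd1 le_db1 le_ac2 le_cd2 le_db2.
  have -> : (a2 <= k2.-1) = false by lia.
  have -> : (b2 <= k2.-1) = false by lia.
  have -> : (c2 <= k2.-1) = false by lia.
  have -> : (d2 <= k2.-1) = false by lia.
  have -> : (a1 <= k2.-1) = true by lia.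
  have -> : (b1 <= k2.-1) = false by lia.
  have -> : (c1 <= k2.-1) = false by lia.
  have -> : (d1 <= k2.-1) = false by lia.
  by lia.
move=> u uw [[_ ut]|[_ ut]|[_ ut]|[]] //.
- by case: (ymin u uw ut); clear -k2a ay; lia.
- by case: (ymin u uw ut) => _; clear -k2a ay ym; lia.
- by case: (xmin u uw ut) => _; clear -k2a z2d le_ac2 le_cd2; lia.
Qed.

(** An excess of tag 1 gives slack at every index in [d1 < z <= b1]. This leads to a letter of tag 3
    with an index below [z1]. Exchanging that index with [z1] would turn the letter of tag 1 into
    one of tag 2, unless the index also exceeds [d1]; then slack occurs again. *)
Lemma good_word_tag1_min w w' : good_word w -> all letter_ok w' -> same_content w w' ->
  tag_count 3 w = tag_count 3 w' -> tag_count 1 w <= tag_count 1 w'.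
Proof.
move=> gw ok' sc e3; rewrite leqNgt; apply/negP => lt1.
have ok := good_word_ok gw; have [can good] := gw; move/allP in can.
have [e0 e12 e34] := same_content_type ok ok' sc.
have [x [xw xt xmin]] := min_letter gw (leq_ltn_trans (leq0n _) lt1) isT.
case: x xt xw xmin => t [j z1] /= -> xw xmin.
have cx := can _ xw; have /letter_okP := canonical_ok cx.
case=> [[]|[]|[]|[[]|[]]] //= _ ja zb.
have z1d : d1 < z1 by move: cx => /andP [].
have z0 : 0 < z1 := leq_ltn_trans (leq0n _) z1d.
have sl s z := @slack_letter w w' s z gw ok' sc.
have slack z : d1 < z -> z <= b1 -> cap_count z.-1 w < cap_count z.-1 w'.
  move=> dz zb1; rewrite !cap_countE // e0.
  clear -lt1 e3 e12 e34 dz zb1 le_ac1 le_cd1 le_db1.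
  have -> : (a1 <= z.-1) = true by lia.
  have -> : (b1 <= z.-1) = false by lia.
  have -> : (c1 <= z.-1) = true by lia.
  have -> : (d1 <= z.-1) = true by lia.
  by lia.
have okB1 l h : l <= c1 -> h <= d1 -> letter_ok (2, (l, h)).
  by rewrite /letter_ok /slots /= /slot_cap /= => -> ->.
have okA2 l h : l <= a2 -> h <= b2 -> letter_ok (3, (l, h)).
  by rewrite /letter_ok /slots /= /slot_cap /= => -> ->.
have jc := leq_trans ja le_ac1.
have hi2 u : u \in w -> u.1 = 3 -> u.2.2 < z1 -> z1 <= b2 -> False.
  move=> uw ut uz z1b2.
  have [y [yw yt ymin]] := min_letter gw (tag_count_lt_mem uw ut) isT.
  case: y yt yw ymin => t' [k2 z2] /= -> yw ymin.
  have cy := can _ yw; have /letter_okP := canonical_ok cy.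
  case=> [[]|[]|[]|[[]|[]]] //= _ k2a z2b.
  have z21 : z2 < z1 by case: (ymin u uw ut) => _ le; apply: leq_ltn_trans le uz.
  have gd : good_pair (1, (j, z1)) (3, (k2, z2)) by apply: good.
  case: (leqP z2 d1) => z2d.
    apply: (improve gd cx cy (okB1 _ _ jc z2d) (okA2 _ _ k2a z1b2)); last by left.
    by apply/andP; split=> //; have [_ + _] := perm4 j z1 k2 z2.
  (* If [z2] also exceeds [d1], there is slack at class 9, above which no class exists. *)
  have m9 : (9, z2) \in word_slots w := @mem_slot true _ _ yw isT.
  have min9 v : (9, v) \in word_slots w -> z2 <= v.
    move=> vw; have [y' yw'] := prior_slot ok vw isT.
    by case=> [[]|[]|[yt [->]]|[[]|[]]] //; case: (ymin y' yw' yt).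
  have [] := sl 9 z2 isT (leq_ltn_trans (leq0n _) z2d) m9 min9.
    by apply: slack => //; apply: leq_trans (ltnW z21) zb.
  by move=> v _ [[]|[]|[]|[]].
have m5 : (5, z1) \in word_slots w := @mem_slot true _ _ xw isT.
have min5 v : (5, v) \in word_slots w -> z1 <= v.
  move=> vw; have [y' yw'] := prior_slot ok vw isT.
  by case=> [[]|[]|[]|[[]|[yt [->]]]] //; case: (xmin y' yw' yt).
have [u uw] := sl 5 z1 isT z0 m5 min5 (slack _ z1d zb).
case=> [[_ _]|[_ _]|[_ ut /andP [lt le]]|[_ ut /andP [lt le]]].
- by clear -z1d le_cd1; lia.
- by clear -z1d; lia.
- exact: hi2 uw ut lt le.
have [y [yw yt ymin]] := min_letter gw (tag_count_lt_mem uw ut) isT.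
case: y yt yw ymin => t' [k2 h] /= -> yw ymin.
have cy := can _ yw; have /letter_okP := canonical_ok cy.
case=> [[]|[]|[]|[[]|[]]] //= _ k2a hb.
have k21 : k2 < z1 by case: (ymin u uw ut) => + _ => /leq_ltn_trans; apply.
have gd : good_pair (1, (j, z1)) (3, (k2, h)) by apply: good.
case: (leqP k2 d1) => k2d.
  apply: (improve gd cx cy (okB1 _ _ jc k2d) (okA2 _ _ le hb)); last by left.
  by apply/andP; split=> //; have [_ _ +] := perm4 j z1 k2 h.
(* If [k2] exceeds [d1], slack at [k2] produces a high index below [k2] in a letter of tag 3, which
   is the case [hi2]. *)
have m6 : (6, k2) \in word_slots w := @mem_slot false _ _ yw isT.
have min6 v : (6, v) \in word_slots w -> k2 <= v.
  move=> vw; have [y' yw'] := prior_slot ok vw isT.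
  by case=> [[]|[]|[]|[[yt [->]]|[]]] //; case: (ymin y' yw' yt).
have [] := sl 6 k2 isT (leq_ltn_trans (leq0n _) k2d) m6 min6.
  by apply: slack => //; apply: leq_trans (ltnW k21) zb.
move=> v vw [[_ _]|[_ _]|[_ vt]|[]] //.
- by clear -k2d le_cd1; lia.
- by clear -k2d; lia.
- case/andP => lt2 _; apply: (hi2 v vw vt); first exact: ltn_trans lt2 k21.
  by clear -le le_ac2 le_cd2 le_db2; lia.
Qed.

(* Two lists of pairs with the same first and the same second components agree
   as soon as any two nonempty such lists with property [P] share a pair. *)
Lemma perm_eq_pairs (P : seq (nat * nat) -> Prop) :
    (forall s s', {subset s' <= s} -> P s -> P s') ->
    (forall s s', P s -> P s' -> 0 < size s -> perm_eq (map fst s) (map fst s') ->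
       perm_eq (map snd s) (map snd s') -> exists2 e, e \in s & e \in s') ->
  forall s s', P s -> P s' -> perm_eq (map fst s) (map fst s') ->
    perm_eq (map snd s) (map snd s') -> perm_eq s s'.
Proof.
move=> Psub common s; have [k] := ubnP (size s); elim: k s => // k IH s le_k s' Ps Ps' p1 p2.
have szE : size s = size s' by rewrite -(size_map snd) (perm_size p2) size_map.
case: (posnP (size s)) => [s0|s_gt0].
  by move: szE; rewrite s0 => /esym /size0nil ->; rewrite (size0nil s0).
have [e es es'] := common s s' Ps Ps' s_gt0 p1 p2.
have pr := perm_to_rem es; have pr' := perm_to_rem es'.
rewrite (permPl pr) perm_sym (permPl pr') perm_cons perm_sym; apply: IH.
- by rewrite size_rem //; move: le_k s_gt0; case: (size s).
- by apply: Psub Ps; apply: mem_rem.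
- by apply: Psub Ps'; apply: mem_rem.
- by rewrite -(perm_cons e.1) -(permPl (perm_map fst pr)) -(permPr (perm_map fst pr')).
- by rewrite -(perm_cons e.2) -(permPl (perm_map snd pr)) -(permPr (perm_map snd pr')).
Qed.

(* The largest value sits in the lowest class that can hold it. *)
Lemma stable_unique s s' :
    stable s -> all (fun e => e.2 <= slot_cap e.1) s ->
    stable s' -> all (fun e => e.2 <= slot_cap e.1) s' ->
    perm_eq (map fst s) (map fst s') -> perm_eq (map snd s) (map snd s') ->
  perm_eq s s'.
Proof.
move=> st cap st' cap'; pose P r := stable r /\ all (fun e => e.2 <= slot_cap e.1) r.
apply: (perm_eq_pairs (P := P)) => // {s s' st cap st' cap'} [s s' sub [st /allP cap]|].
  by split; [move=> e e' /sub es /sub; apply: st | apply/allP => e /sub; apply: cap].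
move=> s s' [st cap] [st' cap'] s_gt0 pf ps.
have [q qs qmax] := @seq_max (map snd s) ltac:(by rewrite size_map).
have [t [ts /= tq tmin]] : exists t : nat, [/\ t \in map fst s, q <= slot_cap t &
    forall u, u \in map fst s -> q <= slot_cap u -> t <= u].
  apply: (@seq_argmin _ (fun u => q <= slot_cap u) id).
  have /mapP [e es ->] := qs; apply/hasP; exists e.1; first exact: map_f.
  by move/allP: cap; apply.
have aux r : stable r -> all (fun e => e.2 <= slot_cap e.1) r ->
    perm_eq (map fst s) (map fst r) -> perm_eq (map snd s) (map snd r) -> (t, q) \in r.
  move=> str /allP capr pfr psr.
  have : q \in map snd r by rewrite -(perm_mem psr).
  case/mapP => -[c q'] /= cr eq; rewrite -{}eq in cr.
  have : t \in map fst r by rewrite -(perm_mem pfr).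
  case/mapP => -[t' v] /= tr et; rewrite -{}et in tr.
  have cs : c \in map fst s by rewrite (perm_mem pfr); apply: (map_f fst cr).
  have vs : v \in map snd s by rewrite (perm_mem psr); apply: (map_f snd tr).
  case: (ltngtP t c) (tmin c cs (capr _ cr)) => // [lt|-> //] _.
  case: (str _ _ cr tr lt) => /= le; last by rewrite leqNgt le in tq.
  by have /eqP -> : q == v by rewrite eqn_leq le qmax.
by exists (t, q); apply: aux.
Qed.

Definition cosorted (s : seq (nat * nat)) : Prop :=
  forall e e', e \in s -> e' \in s -> e.1 < e'.1 -> e.2 <= e'.2.

(** The largest first and the largest second component must occur in the same pair. *)
Lemma cosorted_unique s s' : cosorted s -> cosorted s' ->
    perm_eq (map fst s) (map fst s') -> perm_eq (map snd s) (map snd s') ->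
  perm_eq s s'.
Proof.
apply: perm_eq_pairs => {}s {}s'; first by move=> sub st e e' /sub es /sub; apply: st.
move=> st st' s_gt0 pf ps.
have [q qs qmax] := @seq_max (map snd s) ltac:(by rewrite size_map).
have [t ts tmax] := @seq_max (map fst s) ltac:(by rewrite size_map).
have aux r : cosorted r ->
    perm_eq (map fst s) (map fst r) -> perm_eq (map snd s) (map snd r) -> (t, q) \in r.
  move=> str pfr psr.
  have : q \in map snd r by rewrite -(perm_mem psr).
  case/mapP => -[c q'] /= cr eq; rewrite -{}eq in cr.
  have : t \in map fst r by rewrite -(perm_mem pfr).
  case/mapP => -[t' v] /= tr et; rewrite -{}et in tr.
  have cs : c \in map fst s by rewrite (perm_mem pfr); apply: (map_f fst cr).
  have vs : v \in map snd s by rewrite (perm_mem psr); apply: (map_f snd tr).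
  case: (ltngtP c t) (tmax c cs) => // [lt|<- //] _.
  have /= le := str _ _ cr tr lt.
  by have /eqP -> : q == v by rewrite eqn_leq le qmax.
by exists (t, q); apply: aux.
Qed.

(** * Uniqueness of the good word with a given content *)

Lemma word_slots_class w : all letter_ok w ->
  perm_eq (map fst (word_slots w))
   (nseq (tag_count 0 w) 1 ++ nseq (tag_count 1 w) 4 ++ nseq (tag_count 1 w) 5 ++
    nseq (tag_count 2 w) 8 ++ nseq (tag_count 2 w) 7 ++ nseq (tag_count 3 w) 6 ++
    nseq (tag_count 3 w) 9 ++ nseq (tag_count 4 w) 3 ++ nseq (tag_count 4 w) 2).
Proof.
move=> ok; apply/permP => p; rewrite !count_cat !count_nseq -sumn_count.
(* An opaque [f] replaces [p], so that after generalising its products the goal is linear. *)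
have [f fE] : exists f : nat -> nat, forall i, nat_of_bool (p i) = f i by exists p.
rewrite (eq_map fE) !fE.
elim: w ok => [|x w IH] /=; first by rewrite !muln0.
case/andP=> /letter_okP ox /IH {}IH.
rewrite /word_slots /= !map_cat sumn_cat -/(word_slots w) IH /tag_count /= /slots.
move: (count _ w) (count _ w) (count _ w) (count _ w) (count _ w) => n0 n1 n2 n3 n4.
case: ox => [[->]|[->]|[->]|[[->]|[->]]] _ * /=; rewrite /lo_class /hi_class /= ?mulnDr.
all: rewrite !muln0 !muln1 ?add0n; move: (f 1 * _) (f 2 * _) (f 3 * _) (f 4 * _) (f 5 * _)
  (f 6 * _) (f 7 * _) (f 8 * _) (f 9 * _); clear; lia.
Qed.

Lemma same_content_sym w w' : same_content w w' -> same_content w' w.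
Proof. by case/andP => p q; apply/andP; split; rewrite perm_sym. Qed.

Definition tag_pairs t w : seq (nat * nat) := [seq x.2 | x <- w & x.1 == t].

Lemma tag_pairs_slots t w : all letter_ok w -> t < 5 ->
  map fst (tag_pairs t w) = [seq e.2 | e <- word_slots w & e.1 == lo_class t] /\
  (t != 0 -> map snd (tag_pairs t w) = [seq e.2 | e <- word_slots w & e.1 == hi_class t]).
Proof.
elim: w => [|x w IH] //= /andP [/letter_okP ox okw] t5.
have {IH okw} [IH1 IH2] := IH okw t5.
rewrite /word_slots /= !filter_cat !map_cat -/(word_slots w) -IH1 {IH1}.
split=> [|t0]; last rewrite -(IH2 t0); rewrite /tag_pairs /slots /lo_class /hi_class {IH2};
  case: x ox => tx [lx hx] ox.
  by case: t t5 => [|[|[|[|[|//]]]]] _;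
     case: ox => [[/= ->]|[/= ->]|[/= ->]|[[/= ->]|[/= ->]]] * /=.
by case: t t5 t0 => [|[|[|[|[|//]]]]] _ //;
   case: ox => [[/= ->]|[/= ->]|[/= ->]|[[/= ->]|[/= ->]]] * /=.
Qed.

Lemma count_tag_pairs x w : count_mem x w = count_mem x.2 (tag_pairs x.1 w).
Proof.
rewrite count_map count_filter; apply: eq_count => y /=.
by rewrite -pair_eqE andbC /=; case: x y => ? ? [].
Qed.

(** Minimality in both directions equates the counts of tags and hence of classes. Stability then
    fixes the indices in each class, and cosortedness fixes how low and high indices are paired. *)
Theorem good_word_unique w w' : good_word w -> good_word w' -> same_content w w' ->
  perm_eq w w'.
Proof.
move=> gw gw' sc; have ok := good_word_ok gw; have ok' := good_word_ok gw'.
have sc' := same_content_sym sc.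
have [e0 e12 e34] := same_content_type ok ok' sc.
have e3 : tag_count 3 w = tag_count 3 w'.
  by apply/eqP; rewrite eqn_leq !good_word_tag3_min.
have e1 : tag_count 1 w = tag_count 1 w'.
  by apply/eqP; rewrite eqn_leq !good_word_tag1_min.
have cap u : all letter_ok u -> all (fun e => e.2 <= slot_cap e.1) (word_slots u).
  move=> /allP oku; apply/allP => e /mem_word_slots [x /oku ox ex].
  exact: canonical_slot_cap ex.
have pslots : perm_eq (word_slots w) (word_slots w').
  apply: stable_unique; rewrite ?cap //; try exact: good_word_stable.
  - apply: perm_trans (word_slots_class ok) _.
    rewrite perm_sym; apply: perm_trans (word_slots_class ok') _.
    have e2 : tag_count 2 w = tag_count 2 w' by lia.
    have e4 : tag_count 4 w = tag_count 4 w' by lia.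
    by rewrite e0 e1 e2 e3 e4.
  - by case/andP: sc.
have pcl c : perm_eq [seq e.2 | e <- word_slots w & e.1 == c]
                     [seq e.2 | e <- word_slots w' & e.1 == c].
  by apply/perm_map/perm_filter.
apply/allP => x; rewrite mem_cat => xw; apply/eqP.
have x5 : x.1 < 5.
  by case/orP: xw => [/(allP ok)|/(allP ok')] /andP [].
rewrite !count_tag_pairs; suff /permP -> : perm_eq (tag_pairs x.1 w) (tag_pairs x.1 w') by [].
have [lo hi] := tag_pairs_slots ok x5; have [lo' hi'] := tag_pairs_slots ok' x5.
have plo : perm_eq (map fst (tag_pairs x.1 w)) (map fst (tag_pairs x.1 w')).
  by rewrite lo lo'.
case: (eqVneq x.1 0) => [x0|x0]; last first.
  have cos u : good_word u -> cosorted (tag_pairs x.1 u).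
    move=> gu e e' /mapP [y + ->] /mapP [y' + ->]; rewrite !mem_filter.
    move=> /andP [/eqP t yw] /andP [/eqP t' yw'].
    by apply: (good_word_cosorted gu); rewrite ?t ?t'.
  by apply: cosorted_unique; rewrite ?hi ?hi' //; apply: cos.
have z u : good_word u -> tag_pairs 0 u = [seq (v, 0) | v <- map fst (tag_pairs 0 u)].
  move=> [/allP can _]; rewrite -map_comp -[LHS]map_id; apply/eq_in_map => e.
  case/mapP => y; rewrite mem_filter => /andP [/eqP y0 /can /andP [_]] + ->.
  by rewrite y0 /=; case: y.2 => a b /= /eqP ->.
by rewrite x0 in plo *; rewrite (z _ gw) (z _ gw'); apply: perm_map.
Qed.

End PairWords.
(** * The staircase of an ideal with two Borel generators of degree two *)

Definition staircase (a b c d k l : nat) : bool :=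
  ((k <= a) && (l <= b) || (k <= c) && (l <= d))%N.

Section BorelRegion.

Variables (K : fieldType) (n : nat).
Local Notation S := {mpoly K[n]}.

Lemma mdeg2P (u : 'X_{1..n}) : mdeg u = 2%N ->
  exists k l : 'I_n, (k <= l)%N /\ u = (U_(k) + U_(l))%MM.
Proof.
move=> du; have [k uk] : exists k, u k != 0%N.
  by apply: mnm_neq0_exists; rewrite -mdeg_eq0 du.
have e : u = (u - U_(k) + U_(k))%MM by rewrite submK // lep1mP.
have /eqP /mdeg1P [l /eqP el] : mdeg (u - U_(k))%MM = 1%N.
  by move: du; rewrite e mdegD mdeg1 addmK addn1 => -[].
rewrite el in e; case: (leqP k l) => [kl|/ltnW lk].
  by exists k, l; split; rewrite // addmC.
by exists l, k.
Qed.

Lemma mnm_pair_inj (k l k' l' : 'I_n) : (k <= l)%N -> (k' <= l')%N ->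
  (U_(k) + U_(l) = U_(k') + U_(l'))%MM -> k = k' /\ l = l'.
Proof.
move=> kl kl' /mnmP e.
have ek : (k == k') || (k == l').
  have := e k; rewrite !mnmDE !mnm1E eqxx ![_ == k]eq_sym.
  by case: (k == k') => //; case: (k == l').
case: (eqVneq k k') ek e => [<- _ e|ne /eqP kl2 e].
  split=> //; have := e l; rewrite !mnmDE !mnm1E eqxx => /eqP.
  by rewrite eqn_add2l; case: (eqVneq l' l) => [->|].
have := e k'; rewrite !mnmDE !mnm1E eqxx (negbTE ne) -kl2 (negbTE ne) addn0.
by case: (eqVneq l k') => // lk' _; case/eqP: ne; apply: ord_inj; move: kl kl'; rewrite lk' -kl2; lia.
Qed.

Lemma borel_pair_closed (I : ideal S) (k l k' l' : 'I_n) : strongly_stable I ->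
  'X_[U_(k) + U_(l)] \in I -> (k' <= k)%N -> (l' <= l)%N -> 'X_[U_(k') + U_(l')] \in I.
Proof.
move=> [_ st] m kk ll.
have step (i j i' : 'I_n) : 'X_[U_(i) + U_(j)] \in I -> (i' <= i)%N -> 'X_[U_(i') + U_(j)] \in I.
  rewrite leq_eqVlt => mi /orP [/eqP/ord_inj -> //|lt].
  have := st _ i i' mi _ lt; rewrite mnmDE mnm1E eqxx => /(_ isT).
  by rewrite [(U_(i) + _)%MM]addmC addmK addmC.
by apply: (step) kk; rewrite addmC; apply: (step) ll; rewrite addmC.
Qed.

(** The pairs below one of the two generators generate a strongly stable ideal [J], so minimality
    puts [I] inside [J]. *)
Lemma borel_two_generators (G : seq 'X_{1..n}) (I : ideal S) :
    is_borel_ideal G I -> size G = 2%N -> (forall m, m \in G -> mdeg m = 2%N) ->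
  exists a b c d : nat, [/\ (a <= c <= d)%N, (d <= b < n)%N,
    mset_gen (fun p => 'X_[p] \in I) 2 &
    forall k l : 'I_n, (k <= l)%N -> 'X_[U_(k) + U_(l)] \in I <-> staircase a b c d k l].
Proof.
case: G => [|g1 [|g2 []]] // [stI GI Imin] _ dG.
have [k1 [l1 [kl1 e1]]] := mdeg2P (dG g1 (mem_head _ _)).
have [k2 [l2 [kl2 e2]]] : exists k l : 'I_n, (k <= l)%N /\ g2 = (U_(k) + U_(l))%MM.
  by apply/mdeg2P/dG; rewrite !inE eqxx orbT.
pose R (k l : 'I_n) := staircase k1 l1 k2 l2 k l.
pose X : set 'X_{1..n} := fun m =>
  exists k l : 'I_n, [/\ (k <= l)%N, R k l & m = (U_(k) + U_(l))%MM].
pose J : ideal S := ideal_gen [set 'X_[m] | m in X]%classic.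
have JX := @ideal_of_mset_gen K n X; rewrite -/J in JX.
have memJ p : 'X_[p] \in J <-> exists2 m, X m & (m <= p)%MM by exact: (ideal_of_msetX p JX).
have RI (k l : 'I_n) : (k <= l)%N -> R k l -> 'X_[U_(k) + U_(l)] \in I.
  move=> kl /orP [] /andP [kk ll].
    by apply: (borel_pair_closed stI _ kk ll); rewrite -e1; apply: GI; rewrite mem_head.
  by apply: (borel_pair_closed stI _ kk ll); rewrite -e2; apply: GI; rewrite !inE eqxx orbT.
have stJ : strongly_stable J.
  split; first by exists X.
  move=> m i j /memJ [_ [k [l [kl Rkl ->]]] /mnm_lepP le] mi ji; apply/memJ.
  have leE (x : 'I_n) : ((x == k) + (x == l) <= m x)%N by have := le x; rewrite mnmDE !mnm1E ![_ == x]eq_sym.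
  case: (eqVneq i k) => [ik|i_k].
    exists (U_(j) + U_(l))%MM.
      exists j, l; rewrite -ik in kl *; split=> //; first by apply: leq_trans (ltnW ji) kl.
      by move: Rkl; rewrite -ik /R /staircase; lia.
    apply/mnm_lepP => x; rewrite !mnmDE mnmBE !mnm1E addnC leq_add2r.
    by have := leE x; rewrite ik ![_ == x]eq_sym; case: (x == k); case: (x == l) => /=; lia.
  case: (eqVneq i l) => [il|i_l]; last first.
    exists (U_(k) + U_(l))%MM; first by exists k, l.
    apply/mnm_lepP => x; rewrite !mnmDE mnmBE !mnm1E ![_ == x]eq_sym.
    case: (eqVneq x i) => [->|_]; first by rewrite (negbTE i_k) (negbTE i_l).
    by rewrite subn0; apply: leq_trans (leE x) (leq_addr _ _).
  exists (U_(k) + U_(j))%MM.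
    case: (leqP k j) => [kj|jk].
      by exists k, j; split=> //; move: Rkl; rewrite /R /staircase -il; lia.
    exists j, k; split; [exact: ltnW | | by rewrite addmC].
    by move: Rkl; rewrite /R /staircase; lia.
  apply/mnm_lepP => x; rewrite !mnmDE mnmBE !mnm1E leq_add2r.
  by have := leE x; rewrite il ![_ == x]eq_sym; case: (x == k); case: (x == l) => /=; lia.
have GJ m : m \in [:: g1; g2] -> 'X_[m] \in J.
  rewrite in_cons mem_seq1 => /orP [] /eqP ->.
    apply/(memJ g1); exists g1; last exact: lepm_refl.
    by exists k1, l1; split=> //; rewrite /R /staircase !leqnn.
  apply/(memJ g2); exists g2; last exact: lepm_refl.
  by exists k2, l2; split=> //; rewrite /R /staircase !leqnn orbT.
have memI p : 'X_[p] \in I -> exists k l : 'I_n,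
    [/\ (k <= l)%N, R k l & (U_(k) + U_(l) <= p)%MM].
  by move=> /(Imin J stJ GJ) /memJ [_ [k [l [kl Rkl ->]]] le]; exists k, l.
have genI : mset_gen (fun p => 'X_[p] \in I) 2.
  move=> p /memI [k [l [kl Rkl le]]]; exists (U_(k) + U_(l))%MM.
  by split; rewrite ?mdegD ?mdeg1 //; apply: RI.
have RE (k l : 'I_n) : (k <= l)%N -> 'X_[U_(k) + U_(l)] \in I <-> R k l.
  move=> kl; split=> [/memI [k' [l' [kl' Rkl' le]]]|]; last exact: RI.
  have e : (U_(k') + U_(l') = U_(k) + U_(l))%MM.
    apply: mnm_le_mdeg_eq; last by rewrite !mdegD !mdeg1.
    by move=> i; move/mnm_lepP: le => /(_ i).
  by have [<- <-] := mnm_pair_inj kl' kl e.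
have [lk1 lk2] := (ltn_ord l1, ltn_ord l2).
(* The corners are sorted by their low index; if one dominates the other, it is used twice. *)
case: (leqP k1 k2) => kk; case: (leqP l1 l2) => ll.
- exists k2, l2, k2, l2; split=> //; rewrite ?leqnn ?kl2 //.
  move=> k l kl; rewrite RE //; rewrite /R /staircase; split; lia.
- by exists k1, l1, k2, l2; split=> //; [rewrite kk kl2 | rewrite (ltnW ll) lk1].
- exists k2, l2, k1, l1; split=> //; [by rewrite (ltnW kk) kl1 | by rewrite ll lk2 | ].
  by move=> k l kl; rewrite RE // /R /staircase orbC.
- exists k1, l1, k1, l1; split=> //; rewrite ?leqnn ?kl1 //.
  move=> k l kl; rewrite RE //; rewrite /R /staircase; split; lia.
Qed.

End BorelRegion.

(** * Exponents of the product of a word *)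

Section WordContents.

Variables (n N : nat) (q : 'I_N -> 'X_{1..n}) (t : 'I_N -> 'X_{1..2}) (om : 'I_N -> nat).

Definition word_q (w : 'X_{1..N}) : 'X_{1..n} := (\sum_i q i *+ w i)%MM.
Definition word_t (w : 'X_{1..N}) : 'X_{1..2} := (\sum_i t i *+ w i)%MM.

(* A pair of letters is good when it has the least weight among the pairs with
   the same product. *)
Definition least_pair (i j : 'I_N) : bool :=
  [forall i' : 'I_N, forall j' : 'I_N,
    (q i + q j == q i' + q j')%MM && (t i + t j == t i' + t j')%MM ==>
    (om i + om j <= om i' + om j')%N].

Lemma word_qE w v : word_q w v = (\sum_i w i * q i v)%N.
Proof. by rewrite /word_q mnm_sumE; apply: eq_bigr => i _; rewrite mulmnE mulnC. Qed.

Lemma word_tE w o : word_t w o = (\sum_i w i * t i o)%N.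
Proof. by rewrite /word_t mnm_sumE; apply: eq_bigr => i _; rewrite mulmnE mulnC. Qed.

End WordContents.

Definition ideal_index (b : bool) : 'I_2 := if b then 1 else 0.

(** * Canonical letters as monomial generators *)

Section LetterPresentation.

Variables (n : nat) (aa bb cc dd : bool -> nat) (t0 : bool).
Hypothesis regions : forall b, [/\ (aa b <= cc b)%N, (cc b <= dd b)%N,
  (dd b <= bb b)%N & (bb b < n)%N].
(** [t0] names the ideal in the role of the second staircase, so this is the condition [c1 <= d2].
    Indices are ordinals below [n], whence the capacity [n.-1] in what follows. *)
Hypothesis cross : (cc (~~ t0) <= dd t0)%N.

Local Notation t1 := (~~ t0).
Local Notation canon := (canonical n.-1 (aa t1) (cc t1) (dd t1) (bb t1) (aa t0) (cc t0) (dd t0) (bb t0)).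
Local Notation lok := (letter_ok n.-1 (aa t1) (cc t1) (dd t1) (bb t1) (aa t0) (cc t0) (dd t0) (bb t0)).

Definition ord_letter (z : 'I_5 * ('I_n * 'I_n)) : letter :=
  (nat_of_ord z.1, (nat_of_ord z.2.1, nat_of_ord z.2.2)).
Definition letter_set : {set 'I_5 * ('I_n * 'I_n)} := [set z | canon (ord_letter z)]%SET.
Local Notation N := #|letter_set|.
Definition letter_of (i : 'I_N) : letter := ord_letter (enum_val i).

Definition type_code (o : 'I_2) : nat := if o == ideal_index t0 then 2 else 1.

Definition letter_q (x : letter) : 'X_{1..n} :=
  [multinom count_mem (nat_of_ord v) (word_vars [:: x]) | v < n].
Definition letter_t (x : letter) : 'X_{1..2} :=
  [multinom count_mem (type_code o) [:: letter_type x] | o < 2].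

Definition word_letters (w : 'X_{1..N}) : seq letter :=
  flatten [seq nseq (w i) (letter_of i) | i <- enum 'I_N].

Lemma letter_of_inj : injective letter_of.
Proof.
move=> i j; rewrite /letter_of /ord_letter => -[e1 e2 e3]; apply: enum_val_inj.
by move: e1 e2 e3; case: (enum_val i) (enum_val j) => a [b c] [a' [b' c']] /=
   /ord_inj -> /ord_inj -> /ord_inj ->.
Qed.

Lemma letter_of_canon i : canon (letter_of i).
Proof. by have := enum_valP i; rewrite inE. Qed.

Lemma n_gt0 : (0 < n)%N.
Proof. by have [_ _ _] := regions t0; case: (n). Qed.

Lemma letter_of_surj x : canon x -> exists i, letter_of i = x.
Proof.
move=> cx; have x_ok := canonical_ok cx.
have n0 := n_gt0; have [? ? ? ?] := regions t0; have [? ? ? ?] := regions t1.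
have [x5 xl xh] : [/\ x.1 < 5, x.2.1 < n & x.2.2 < n]%N.
  have := cx; rewrite /canonical => /andP [_]; case: x cx x_ok => tx [l h] cx x_ok /= h0.
  have /letter_okP := x_ok.
  case=> [[/= e ?]|[/= e ? ?]|[/= e ? ?]|[[/= e ? ?]|[/= e ? ?]]]; split; rewrite ?e //; try lia.
  by move: h0; rewrite e /= => /eqP ->.
pose z : 'I_5 * ('I_n * 'I_n) := (Ordinal x5, (Ordinal xl, Ordinal xh)).
have ez : ord_letter z = x by rewrite /ord_letter /=; case: x {z cx x_ok x5 xl xh} => ? [].
have zY : z \in letter_set by rewrite inE ez.
by exists (enum_rank_in zY z); rewrite /letter_of enum_rankK_in.
Qed.

Lemma count_word_vars s v :
  count_mem v (word_vars s) = (\sum_(x <- s) count_mem v (word_vars [:: x]))%N.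
Proof.
elim: s => [|x s IH]; first by rewrite big_nil.
rewrite big_cons -IH -count_cat -map_cat /word_vars /word_slots /=.
by rewrite cats0.
Qed.

Lemma sum_word_letters w (F : letter -> nat) :
  (\sum_(x <- word_letters w) F x = \sum_i w i * F (letter_of i))%N.
Proof.
rewrite big_flatten big_map big_enum /=; apply: eq_bigr => i _.
by rewrite big_nseq iter_addn_0 mulnC.
Qed.

Lemma count_sum (T : Type) (p : pred T) (s : seq T) : count p s = (\sum_(x <- s) p x)%N.
Proof. by elim: s => [|x s IH]; rewrite ?big_nil // big_cons -IH. Qed.

Lemma count_word_letters w x :
  count_mem x (word_letters w) = (\sum_i w i * (letter_of i == x))%N.
Proof. by rewrite count_sum (sum_word_letters w (fun y => (y == x) : nat)). Qed.

Lemma word_letters_inj w w' : perm_eq (word_letters w) (word_letters w') -> w = w'.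
Proof.
move/permP => e; apply/mnmP => i; have := e (pred1 (letter_of i)).
have cE u : count_mem (letter_of i) (word_letters u) = u i.
  rewrite count_word_letters (bigD1 i) //= eqxx muln1 big1 ?addn0 // => j ne.
  by rewrite (inj_eq letter_of_inj) (negbTE ne) muln0.
by rewrite !cE.
Qed.

Lemma mem_word_letters w x : x \in word_letters w -> exists2 i, w i != 0%N & letter_of i = x.
Proof.
case/flatten_mapP => i _; rewrite mem_nseq => /andP [wi /eqP ->].
by exists i; rewrite // -lt0n.
Qed.

Local Notation lq := (fun i => letter_q (letter_of i)).
Local Notation lt := (fun i => letter_t (letter_of i)).
Local Notation lw := (fun i => letter_wt n.-1 (letter_of i)).

Lemma word_q_count w (v : 'I_n) :
  word_q lq w v = count_mem (nat_of_ord v) (word_vars (word_letters w)).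
Proof.
rewrite word_qE count_word_vars sum_word_letters; apply: eq_bigr => i _.
by rewrite mnmE.
Qed.

Lemma word_t_count w (o : 'I_2) :
  word_t lt w o = count_mem (type_code o) (map letter_type (word_letters w)).
Proof.
rewrite word_tE count_map count_sum.
rewrite (sum_word_letters w (fun y => (letter_type y == type_code o) : nat)).
by apply: eq_bigr => i _; rewrite mnmE /= addn0.
Qed.

Lemma word_letters_canon w : all canon (word_letters w).
Proof. by apply/allP => x /mem_word_letters [i _ <-]; apply: letter_of_canon. Qed.

Lemma word_vars_lt w v : v \in word_vars (word_letters w) -> (v < n)%N.
Proof.
case/mapP => e /mem_word_slots [x /mem_word_letters [i _ <-] ex] ->.
move: ex; rewrite /slots /=; case: ifP => _; rewrite !inE.
  by move/eqP => -> /=.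
by case/orP => /eqP -> /=.
Qed.

Lemma type_codeP c : c != 0%N -> (c < 3)%N -> exists o, type_code o = c.
Proof.
case: c => [|[|[|//]]] // _ _.
  by exists (ideal_index t1); rewrite /type_code; case: (t0).
by exists (ideal_index t0); rewrite /type_code eqxx.
Qed.

Lemma size_word_vars s : all lok s -> size (word_vars s) =
  (count_mem 0%N (map letter_type s) +
   2 * (count_mem 1%N (map letter_type s) + count_mem 2%N (map letter_type s)))%N.
Proof.
elim: s => // x s IH /= /andP [/letter_okP ox /IH {}IH].
rewrite /word_vars /word_slots /= map_cat size_cat -/(word_vars s) IH /slots /letter_type.
by case: ox => [[->]|[->]|[->]|[[->]|[->]]] * /=; lia.
Qed.

(** The exponents of [t] count the letters of types 1 and 2; the number of variables then follows
    from the total number of indices. *)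
Lemma word_same_content w w' : word_q lq w = word_q lq w' -> word_t lt w = word_t lt w' ->
  same_content (word_letters w) (word_letters w').
Proof.
move=> eq et.
have pv : perm_eq (word_vars (word_letters w)) (word_vars (word_letters w')).
  apply/allP => v; rewrite mem_cat => vw; apply/eqP.
  have vn : (v < n)%N by case/orP: vw => /word_vars_lt.
  by rewrite -[v]/(nat_of_ord (Ordinal vn)) -!word_q_count eq.
apply/andP; split=> //; apply/allP => c; rewrite mem_cat => cw; apply/eqP.
have c3 : (c < 3)%N.
  have ty x : canon x -> (letter_type x < 3)%N.
    by move=> /canonical_ok /letter_okP; rewrite /letter_type => -[[->]|[->]|[->]|[[->]|[->]]].
  by case/orP: cw => /mapP [x /mem_word_letters [i _ <-] ->]; apply/ty/letter_of_canon.
have types k : k != 0%N -> (k < 3)%N ->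
    count_mem k (map letter_type (word_letters w)) = count_mem k (map letter_type (word_letters w')).
  by move=> k0 /(type_codeP k0) [o <-]; rewrite -!word_t_count et.
case: (eqVneq c 0%N) => [->|c0]; last exact: types.
have ok u : all lok (word_letters u).
  by apply: sub_all (word_letters_canon u) => x; apply: canonical_ok.
have := perm_size pv; rewrite !size_word_vars // !(types 1%N) // !(types 2%N) //.
by move/eqP; rewrite eqn_add2r => /eqP.
Qed.

Lemma same_content_pair (i j i' j' : 'I_N) :
    same_content [:: letter_of i; letter_of j] [:: letter_of i'; letter_of j'] ->
  (lq i + lq j = lq i' + lq j')%MM /\ (lt i + lt j = lt i' + lt j')%MM.
Proof.
case/andP => /permP pv /permP pt; split; apply/mnmP => v; rewrite !mnmDE !mnmE.
  have := pv (pred1 (nat_of_ord v)); rewrite !(count_word_vars [:: _; _]) !big_cons !big_nil.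
  by rewrite !addn0.
by have := pt (pred1 (type_code v)); rewrite /= !addn0.
Qed.

(** [least_pair] compares canonical letters only, so a competing valid pair is first replaced by
    canonical letters of the same content and no larger weight. *)
Lemma least_good_word w : word_std (least_pair lq lt lw) w ->
  good_word n.-1 (aa t1) (cc t1) (dd t1) (bb t1) (aa t0) (cc t0) (dd t0) (bb t0) (word_letters w).
Proof.
move=> /word_stdP sw; split; first exact: word_letters_canon.
move=> x y /mem_word_letters [i wi <-] /mem_word_letters [j wj <-].
rewrite (inj_eq letter_of_inj) => ne x' y' ox' oy' sc.
have le : (U_(i) + U_(j) <= w)%MM by apply: mnm1_add_le; rewrite ?lt0n.
have [? ? ? ?] := regions t0; have [? ? ? ?] := regions t1.
have canonP z : lok z -> exists k, same_content [:: z] [:: letter_of k] /\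
    (letter_wt n.-1 (letter_of k) <= letter_wt n.-1 z)%N.
  move=> oz.
  have [z' [/letter_of_surj [k <-] sz wz]] : exists z', [/\ canon z',
      same_content [:: z] [:: z'] & (letter_wt n.-1 z' <= letter_wt n.-1 z)%N].
    by apply: letter_wt_le_canonical oz; lia.
  by exists k.
have [i' [si wi']] := canonP _ ox'; have [j' [sj wj']] := canonP _ oy'.
have sc' : same_content [:: letter_of i; letter_of j] [:: letter_of i'; letter_of j'].
  apply: same_content_trans sc _; case/andP: si => si1 si2; case/andP: sj => sj1 sj2.
  have wv u u' : word_vars [:: u; u'] = word_vars [:: u] ++ word_vars [:: u'].
    by rewrite /word_vars /word_slots /= !cats0 map_cat.
  by apply/andP; rewrite !wv; split; [apply: perm_cat | exact: (perm_cat si2 sj2)].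
have [eq et] := same_content_pair sc'.
move: (sw i j le) => /forallP /(_ i') /forallP /(_ j') /implyP; rewrite eq et !eqxx => /(_ isT).
by move=> H; apply: leq_trans H _; apply: leq_add.
Qed.

Theorem least_word_unique w w' :
    word_std (least_pair lq lt lw) w -> word_std (least_pair lq lt lw) w' ->
  word_q lq w = word_q lq w' -> word_t lt w = word_t lt w' -> w = w'.
Proof.
move=> sw sw' eq et; apply: word_letters_inj.
have [? ? ? ?] := regions t0; have [? ? ? ?] := regions t1.
apply: good_word_unique (least_good_word sw) (least_good_word sw') (word_same_content eq et) => //; lia.
Qed.

Variable M : bool -> 'X_{1..n} -> Prop.
Hypothesis M_region : forall b (k l : 'I_n), (k <= l)%N ->
  M b (U_(k) + U_(l))%MM <-> staircase (aa b) (bb b) (cc b) (dd b) k l.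

Lemma letter_q_var (l : 'I_n) h : letter_q (0%N, (nat_of_ord l, h)) = U_(l)%MM.
Proof. by apply/mnmP => v; rewrite mnmE mnm1E /= addn0. Qed.

Lemma letter_q_pair s (k l : 'I_n) :
  letter_q (s.+1, (nat_of_ord k, nat_of_ord l)) = (U_(k) + U_(l))%MM.
Proof. by apply/mnmP => v; rewrite mnmE mnmDE !mnm1E /= addn0. Qed.

Lemma letter_t_var p : letter_t (0%N, p) = 0%MM.
Proof.
by apply/mnmP => o; rewrite mnmE mnm0E /= addn0 /type_code /letter_type; case: ifP.
Qed.

Lemma letter_t_pair s p : (s < 4)%N ->
  letter_t (s.+1, p) = U_(ideal_index (if (s < 2)%N then t1 else t0))%MM.
Proof.
move=> s4; apply/mnmP => o; rewrite mnmE mnm1E /= addn0 /type_code /letter_type.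
have -> : (o == ideal_index t0) = ~~ (o == ideal_index t1).
  by case: o => [[|[|//]] io]; case: (t0).
rewrite [in RHS]eq_sym; case: s s4 => [|[|[|[|//]]]] _ /=.
- by case: (o == ideal_index t1).
- by case: (o == ideal_index t1).
- by rewrite -[t0 in RHS]negbK; case: (t0) o => [] [[|[|//]] io].
- by rewrite -[t0 in RHS]negbK; case: (t0) o => [] [[|[|//]] io].
Qed.

Lemma letter_cases i :
  (exists l, lq i = U_(l)%MM /\ lt i = 0%MM) \/
  (exists b k l, [/\ lq i = (U_(k) + U_(l))%MM, lt i = U_(ideal_index b)%MM &
                     M b (U_(k) + U_(l))%MM]).
Proof.
have := letter_of_canon i; rewrite /letter_of /ord_letter.
have [a [k [l ->]]] : exists (a : 'I_5) (k l : 'I_n), enum_val i = (a, (k, l)).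
  by case: (enum_val i) => a [k l]; exists a, k, l.
rewrite /=.
move=> ca; have := canonical_ok ca => /letter_okP /=.
have /andP [_ /=] := ca; have [r1 r2 r3 r4] := regions t0; have [r5 r6 r7 r8] := regions t1.
case: a ca => [[|s] s5] /= ca can ok; first by left; exists k; rewrite letter_q_var letter_t_var.
right; exists (if (s < 2)%N then t1 else t0), k, l.
rewrite letter_q_pair letter_t_pair //; split=> //.
suff [kl st] : (k <= l)%N /\ (if (s < 2)%N then staircase (aa t1) (bb t1) (cc t1) (dd t1) k l
    else staircase (aa t0) (bb t0) (cc t0) (dd t0) k l).
  by apply/M_region => //; move: st; case: ifP.
case: ok => [[//]|[[e] kc lc]|[[e] kc lc]|[[[e] kc lc]|[[e] kc lc]]]; move: can;
  rewrite e /= /staircase => can; clear -can kc lc r1 r2 r3 r5 r6 r7; split; lia.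
Qed.

Lemma letter_var (l : 'I_n) : exists i, lq i = U_(l)%MM /\ lt i = 0%MM.
Proof.
have [|i ei] := @letter_of_surj (0%N, (nat_of_ord l, 0%N)).
  by rewrite /canonical /letter_ok /slots /= /slot_cap /=; have := ltn_ord l; lia.
by exists i; rewrite ei letter_q_var letter_t_var.
Qed.

Lemma letter_gen b u : M b u -> mdeg u = 2%N ->
  exists i, lq i = u /\ lt i = U_(ideal_index b)%MM.
Proof.
move=> Mu /mdeg2P [k [l [kl eu]]]; move: Mu; rewrite eu => /(M_region _ kl) st.
suff [s [s4 sb cs]] : exists s, [/\ (s < 4)%N, (if (s < 2)%N then t1 else t0) = b &
    canon (s.+1, (nat_of_ord k, nat_of_ord l))].
  have [i ei] := letter_of_surj cs.
  by exists i; rewrite ei letter_q_pair letter_t_pair // sb.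
have [r1 r2 r3 r4] := regions t0; have [r5 r6 r7 r8] := regions t1.
case: (eqVneq b t1) => [eb|nb].
  case: (leqP l (dd b)) => le; [exists 1%N | exists 0%N];
  rewrite eb; split=> //; move: st le; rewrite /staircase /canonical /letter_ok /slots /= /slot_cap /= eb; lia.
have eb : b = t0 by move: nb; case: (b); case: (t0).
case: (leqP l (dd b)) => le; [exists 3%N | exists 2%N];
rewrite eb; split=> //; move: st le; rewrite /staircase /canonical /letter_ok /slots /= /slot_cap /= eb; lia.
Qed.

End LetterPresentation.
(** * The multi-Rees algebra *)

Lemma mnm_addACA (n : nat) : interchange (@mnm_add n) (@mnm_add n).
Proof. by move=> u v w z; apply/mnmP => i; rewrite !mnmDE addnACA. Qed.

Section ReesKoszul.

Variables (K : fieldType) (n : nat) (I1 I2 : ideal {mpoly K[n]}).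
Local Notation S := {mpoly K[n]}.
Local Notation A := (rees I1 I2).
Local Notation M := (fun (b : bool) (p : 'X_{1..n}) => 'X_[p] \in (if b then I2 else I1)).

Variables (N : nat) (q : 'I_N -> 'X_{1..n}) (t : 'I_N -> 'X_{1..2}) (om : 'I_N -> nat).
Hypothesis M_ideal : forall b : bool, ideal_of_mset (if b then I2 else I1) (M b).
Hypothesis M_gen : forall b, mset_gen (M b) 2.
Hypothesis letters : forall i,
  (exists l, q i = U_(l)%MM /\ t i = 0%MM) \/
  (exists b k l, [/\ q i = (U_(k) + U_(l))%MM, t i = U_(ideal_index b)%MM &
                     M b (U_(k) + U_(l))%MM]).
Hypothesis letters_var : forall l, exists i, q i = U_(l)%MM /\ t i = 0%MM.
Hypothesis letters_gen : forall b u, M b u -> mdeg u = 2%N ->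
  exists i, q i = u /\ t i = U_(ideal_index b)%MM.
Hypothesis letters_unique : forall w w',
  word_std (least_pair q t om) w -> word_std (least_pair q t om) w' ->
  word_q q w = word_q q w' -> word_t t w = word_t t w' -> w = w'.

Local Notation std := (word_std (least_pair q t om)).

Lemma word_qD v w : word_q q (v + w) = (word_q q v + word_q q w)%MM.
Proof.
apply/mnmP => x; rewrite mnmDE !word_qE -big_split /=.
by apply: eq_bigr => i _; rewrite mnmDE mulnDl.
Qed.

Lemma word_tD v w : word_t t (v + w) = (word_t t v + word_t t w)%MM.
Proof.
apply/mnmP => x; rewrite mnmDE !word_tE -big_split /=.
by apply: eq_bigr => i _; rewrite mnmDE mulnDl.
Qed.

Lemma word_q1 i : word_q q U_(i) = q i.
Proof.
apply/mnmP => x; rewrite word_qE (bigD1 i) //= mnm1E eqxx mul1n big1 ?addn0 // => j ne.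
by rewrite mnm1E eq_sym (negbTE ne).
Qed.

Lemma word_t1 i : word_t t U_(i) = t i.
Proof.
apply/mnmP => x; rewrite word_tE (bigD1 i) //= mnm1E eqxx mul1n big1 ?addn0 // => j ne.
by rewrite mnm1E eq_sym (negbTE ne).
Qed.

Lemma word_q0 : word_q q 0 = 0%MM.
Proof. by apply/mnmP => x; rewrite word_qE mnm0E big1 // => i _; rewrite mnm0E. Qed.

Lemma word_t0 : word_t t 0 = 0%MM.
Proof. by apply/mnmP => x; rewrite word_tE mnm0E big1 // => i _; rewrite mnm0E. Qed.

(** * The standard words as a basis of the multi-Rees algebra *)

Definition rees_mset (a : 'X_{1..2}) : 'X_{1..n} -> Prop :=
  mset_add (mset_exp (M false) (a 0)) (mset_exp (M true) (a 1)).

Lemma rees_predE f : rees_pred I1 I2 f <-> (forall a p, (f@_a)@_p != 0 -> rees_mset a p).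
Proof.
have JM a := ideal_of_mset_mul (ideal_of_mset_exp (a 0) (M_ideal false))
                               (ideal_of_mset_exp (a 1) (M_ideal true)).
split=> [/asboolP H a p nz|H]; first by have /JM := H a; apply.
by apply/asboolP => a; apply/JM => p; apply: H.
Qed.

Lemma rees_mset_letter i : rees_mset (t i) (q i).
Proof.
have e0 (p : 'X_{1..n}) : p = (p + 0)%MM by rewrite addm0.
case: (letters i) => [[l [-> ->]]|[b [k [l [-> -> Mb]]]]].
  by rewrite /rees_mset !mnm0E; exists U_(l)%MM, 0%MM; split; rewrite ?addm0.
rewrite /rees_mset !mnm1E; case: b Mb => Mb /=.
  by exists 0%MM, (U_(k) + U_(l))%MM; split; rewrite ?add0m //; exists (U_(k) + U_(l))%MM, 0%MM; rewrite addm0.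
by exists (U_(k) + U_(l))%MM, 0%MM; split; rewrite ?addm0 //; exists (U_(k) + U_(l))%MM, 0%MM; rewrite addm0.
Qed.

Lemma rees_letterP i : 'X_[q i] *: 'X_[t i] \in rees_pred I1 I2.
Proof.
apply/rees_predE => a p; rewrite mcoeffZ mcoeffX.
case: (eqVneq (t i) a) => [<-|_]; last by rewrite mulr0 mcoeff0 eqxx.
rewrite mulr1 mcoeffX; case: (eqVneq (q i) p) => [<- _|]; last by rewrite eqxx.
exact: rees_mset_letter.
Qed.

Definition rees_letter i : A := Rees (rees_letterP i).
Local Notation mon := (word_mon rees_letter).

Lemma rees_val_mon w : rees_val (mon w) = 'X_[word_q q w] *: 'X_[word_t t w].
Proof.
rewrite /word_mon (big_morph (@rees_val K n I1 I2) (id1 := 1) (op1 := *%R)) //.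
have -> : \prod_i rees_val (rees_letter i ^+ w i) =
    \prod_i ('X_[q i *+ w i] *: 'X_[t i *+ w i]) :> {mpoly S[2]}.
  apply: eq_bigr => i _; rewrite -!mpolyXn -exprZn.
  by elim: (w i) => [|k IH] //; rewrite !exprS -IH.
rewrite /word_q /word_t; elim/big_rec3: _ => [|i a b c _ ->].
  by rewrite !mpolyX0 scale1r.
by rewrite -scalerAl -scalerAr scalerA -!mpolyXD.
Qed.

(** By [letters_unique] a monomial comes from at most one standard word, whose coordinate is then a
    single coefficient of [f]. Other words get the value 0. *)
Definition rees_cf (f : A) (w : 'X_{1..N}) : K :=
  if std w then ((rees_val f)@_(word_t t w))@_(word_q q w) else 0.

Lemma rees_cf_lin w c f g : rees_cf (c *: f + g) w = c * rees_cf f w + rees_cf g w.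
Proof.
rewrite /rees_cf; case: ifP => _; last by rewrite mulr0 addr0.
have -> : rees_val (c *: f + g) = (c%:MP)%:MP * rees_val f + rees_val g by [].
by rewrite mcoeffD mul_mpolyC mcoeffZ mcoeffD mul_mpolyC mcoeffZ.
Qed.

Lemma rees_cf_mon w v : std w -> rees_cf (mon w) v = (w == v)%:R.
Proof.
move=> sw; rewrite /rees_cf rees_val_mon mcoeffZ mcoeffX; case: ifP => [sv|]; last first.
  by case: (eqVneq w v) => // <-; rewrite sw.
case: (eqVneq (word_t t w) (word_t t v)) => [et|nt].
  rewrite mulr1 mcoeffX; suff -> : (word_q q w == word_q q v) = (w == v) by [].
  by apply/eqP/eqP => [eq|-> //]; apply: letters_unique.
by rewrite mulr0 mcoeff0; case: (eqVneq w v) nt => // ->; rewrite eqxx.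
Qed.

(** A word that is not standard contains a pair with a lighter substitute of the same product; each
    substitution lowers the weight. *)
Lemma rees_mon_nf w : exists v, [/\ std v, mdeg v = mdeg w, mon v = mon w,
  (word_wt om v <= word_wt om w)%N & ~~ std w -> (word_wt om v < word_wt om w)%N].
Proof.
have [k] := ubnP (word_wt om w); elim: k w => // k IH w; rewrite ltnS => le_k.
case: (boolP (std w)) => [sw|]; first by exists w; rewrite sw.
rewrite /word_std negb_forall => /existsP [i]; rewrite negb_forall => /existsP [j].
rewrite negb_imply => /andP [le]; rewrite /least_pair negb_forall => /existsP [i'].
rewrite negb_forall => /existsP [j']; rewrite negb_imply -ltnNge => /andP [/andP [/eqP eq /eqP et] lt].
pose w' := (w - (U_(i) + U_(j)) + (U_(i') + U_(j')))%MM.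
have ew := submK le.
have lt' : (word_wt om w' < word_wt om w)%N.
  by rewrite -[in X in (_ < X)%N]ew !word_wtD !word_wt1 ltn_add2l.
have [v [sv dv mv wv _]] := IH w' (leq_trans lt' le_k).
exists v; split=> //.
- by rewrite dv -[in RHS]ew !mdegD !mdeg1.
- rewrite mv; apply: val_inj; rewrite /= !rees_val_mon -[in RHS]ew.
  by rewrite !word_qD !word_tD !word_q1 !word_t1 eq et.
- exact: leq_trans wv (ltnW lt').
- by move=> _; apply: leq_ltn_trans wv lt'.
Qed.

(** One generator of degree two is split off each of the [k] factors; the cofactors are collected in
    [r], to be written in variables afterwards. *)
Lemma word_q_exp b k p : mset_exp (M b) k p ->
  exists w r, word_t t w = (U_(ideal_index b) *+ k)%MM /\ p = (word_q q w + r)%MM.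
Proof.
elim: k p => [|k IH] p /=.
  by exists 0%MM, p; rewrite word_t0 word_q0 add0m; split=> //; apply/mnmP => o; rewrite mulmnE muln0 mnm0E.
case=> p1 [p2 [/M_gen [u [Mu le du]] /IH [w [r [tw ->]]] ->]].
have [i [qi ti]] := letters_gen Mu du.
exists (U_(i) + w)%MM, (p1 - u + r)%MM; rewrite word_tD word_qD word_t1 word_q1 qi ti tw; split.
  by apply/mnmP => o; rewrite mnmDE !mulmnE mulnS.
by rewrite mnm_addACA [(u + _)%MM]addmC submK.
Qed.

Lemma word_q_var r : exists w, word_t t w = 0%MM /\ word_q q w = r.
Proof.
have [k] := ubnP (mdeg r); elim: k r => // k IH r; rewrite ltnS => le_k.
case: (eqVneq r 0%MM) => [->|nz]; first by exists 0%MM; rewrite word_t0 word_q0.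
have [l rl] := mnm_neq0_exists nz.
have er : r = (r - U_(l) + U_(l))%MM by rewrite submK // lep1mP.
have [|w [tw qw]] := IH (r - U_(l))%MM.
  by apply: leq_trans le_k; rewrite [X in (_ < mdeg X)%N]er mdegD mdeg1 addn1.
have [i [qi ti]] := letters_var l.
by exists (w + U_(i))%MM; rewrite word_tD word_qD word_t1 word_q1 tw qw qi ti addm0.
Qed.

Lemma rees_mset_word a p : rees_mset a p -> exists w, word_t t w = a /\ word_q q w = p.
Proof.
case=> p1 [p2 [m1 m2 ->]].
have [w1 [r1 [t1 ->]]] := @word_q_exp false _ _ m1.
have [w2 [r2 [t2 ->]]] := @word_q_exp true _ _ m2.
have [w3 [t3 q3]] := word_q_var (r1 + r2).
exists (w1 + w2 + w3)%MM; rewrite !word_tD !word_qD t1 t2 t3 q3 mnm_addACA; split=> //.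
apply/mnmP => o; rewrite !mnmDE !mulmnE !mnm1E mnm0E addn0.
by case: o => [[|[|//]] io]; rewrite /= ?mul0n ?mul1n ?addn0 ?add0n; congr (a _); apply: ord_inj.
Qed.

Lemma rees_val_sum (T : Type) (r : seq T) (F : T -> A) :
  rees_val (\sum_(i <- r) F i) = \sum_(i <- r) rees_val (F i).
Proof. by rewrite (big_morph (@rees_val K n I1 I2) (id1 := 0) (op1 := +%R)). Qed.

Lemma rees_mon_span (f : A) : exists r : seq (K * 'X_{1..N}),
  (forall p, p \in r -> std p.2) /\ f = \sum_(p <- r) p.1 *: mon p.2.
Proof.
have H (ap : 'X_{1..2} * 'X_{1..n}) : exists w, std w /\
    (((rees_val f)@_ap.1)@_ap.2 != 0 -> word_t t w = ap.1 /\ word_q q w = ap.2).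
  case: (eqVneq ((rees_val f)@_ap.1)@_ap.2 0) => [_|nz].
    by exists 0%MM; split=> //; apply: word_std_small; rewrite mdeg0.
  have /rees_predE /(_ _ _ nz) /rees_mset_word [w [tw qw]] := rees_valP f.
  have [v [sv _ mv _ _]] := rees_mon_nf w; exists v; split=> // _.
  (* Equal products have equal exponents, as the coefficient at the monomial of [v] shows. *)
  have : rees_val (mon v) = rees_val (mon w) by rewrite mv.
  rewrite !rees_val_mon => /(congr1 (fun g => g@_(word_t t v))).
  rewrite !mcoeffZ !mcoeffX eqxx mulr1 tw qw.
  case: (eqVneq ap.1 (word_t t v)) => [<-|_].
    move/(congr1 (fun g : S => g@_(word_q q v))); rewrite mulr1 !mcoeffX eqxx.
    by case: (eqVneq ap.2 (word_q q v)) => // _ /eqP; rewrite oner_eq0.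
  move/(congr1 (fun g : S => g@_(word_q q v))); rewrite mulr0 mcoeffX eqxx mcoeff0.
  by move/eqP; rewrite oner_eq0.
have [wd Hw] := choice H.
exists [seq (((rees_val f)@_a)@_p, wd (a, p)) | a <- msupp (rees_val f), p <- msupp (rees_val f)@_a].
split=> [x /allpairsPdep [a [p [_ _ ->]]]|]; first by case: (Hw (a, p)).
apply: val_inj; rewrite /= rees_val_sum big_allpairs_dep /= [LHS]mpolyE.
apply: eq_bigr => a _; rewrite {1}[(rees_val f)@_a]mpolyE scaler_suml big_seq [RHS]big_seq.
apply: eq_bigr => p; rewrite mcoeff_msupp => nz; have [_ /(_ nz) /= [tw qw]] := Hw (a, p).
by rewrite rees_val_mon tw qw mul_mpolyC scalerA mul_mpolyC.
Qed.

(** Every monomial of either ideal has a divisor of degree two in it, so the minimal generators are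
    exactly its monomials of degree two. *)
Lemma rees_generatorP g : rees_generator g <-> exists i, g = rees_letter i.
Proof.
have minimal b u : minimal_monomial_generator (if b then I2 else I1) u ->
    exists i, q i = u /\ t i = U_(ideal_index b)%MM.
  case=> /M_gen [v [Mv le dv]] /(_ v Mv le) ev; rewrite ev in Mv dv *.
  exact: letters_gen.
split=> [|[i ->]].
  case=> [[l el]|[u mu eu]|[u mu eu]].
  - have [i [qi ti]] := letters_var l; exists i; apply: val_inj.
    by rewrite /= el qi ti mpolyX0 -mul_mpolyC mulr1.
  - have [i [qi ti]] := minimal false u mu; exists i; apply: val_inj.
    by rewrite /= eu qi ti.
  - have [i [qi ti]] := minimal true u mu; exists i; apply: val_inj.
    by rewrite /= eu qi ti.
case: (letters i) => [[l [qi ti]]|[b [k [l [qi ti Mb]]]]].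
  by constructor 1; exists l; rewrite /= qi ti mpolyX0 -mul_mpolyC mulr1.
have mu : minimal_monomial_generator (if b then I2 else I1) (U_(k) + U_(l))%MM.
  split=> // v /M_gen [v' [_ le' dv']] le.
  have e : v' = (U_(k) + U_(l))%MM.
    apply: mnm_le_mdeg_eq; last by rewrite dv' mdegD !mdeg1.
    by move=> x; have /mnm_lepP := lepm_trans le' le; apply.
  by apply/mnmP => x; apply/eqP; rewrite eqn_leq; move/mnm_lepP: le => -> /=;
     rewrite -e; move/mnm_lepP: le' => ->.
by case: b ti Mb mu => ti Mb mu; [constructor 3|constructor 2]; exists (U_(k) + U_(l))%MM => //=;
   rewrite qi ti.
Qed.

Lemma word_mon_prod d (w : 'X_{1..N}) : mdeg w = d ->
  exists h : 'I_d -> 'I_N, mon w = \prod_j rees_letter (h j).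
Proof.
elim: d w => [|d IH] w dw.
  have /eqP := dw; rewrite mdeg_eq0 => /eqP ->.
  have h (j : 'I_0) : 'I_N by case: j.
  by exists h; rewrite word_mon0 big_ord0.
have [i wi] : exists i, w i != 0%N by apply: mnm_neq0_exists; rewrite -mdeg_eq0 dw.
have ew : w = (U_(i) + (w - U_(i)))%MM by rewrite addmC submK // lep1mP.
have [h eh] : exists h : 'I_d -> 'I_N, mon (w - U_(i)) = \prod_j rees_letter (h j).
  by apply: IH; move: dw; rewrite ew mdegD mdeg1 => -[]; rewrite -ew.
exists (fun j => if unlift ord0 j is Some j' then h j' else i).
rewrite {1}ew word_monD word_mon1 eh big_ord_recl unlift_none; congr (_ * _).
by apply: eq_bigr => j _; rewrite liftK.
Qed.

Lemma prod_word_mon d (g : 'I_d -> A) : (forall j, rees_generator (g j)) ->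
  exists w, mdeg w = d /\ \prod_j g j = mon w.
Proof.
move=> Hg; have /choice [h Hh] j : exists i, g j = rees_letter i by apply/rees_generatorP.
exists (\sum_j U_(h j))%MM; split.
  rewrite mdeg_sum (eq_bigr (fun=> 1%N)) => [|j _]; last exact: mdeg1.
  by rewrite sum_nat_const card_ord muln1.
rewrite (big_morph mon (word_monD rees_letter) (word_mon0 rees_letter)).
by apply: eq_bigr => j _; rewrite word_mon1.
Qed.

(** A product of [d] generators is a word of length [d], and passing to the normal form keeps the
    length. *)
Lemma rees_grE d f : rees_gr d f <-> (forall w, rees_cf f w != 0 -> mdeg w = d).
Proof.
split.
  case=> k [c [g [Hg ->]]] w; rewrite (cf_sum rees_cf_lin) => nz.
  have /existsP [i] : [exists i, rees_cf (c i *: \prod_j g i j) w != 0].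
    apply: contraNT nz; rewrite negb_exists => /forallP H.
    by rewrite big1 // => i _; apply/eqP; have := H i; rewrite negbK.
  have [v [dv ->]] := prod_word_mon (Hg i).
  have [u [su du mu _ _]] := rees_mon_nf v.
  rewrite (cfZ rees_cf_lin) -mu rees_cf_mon //.
  by case: (eqVneq u w) => [<- _|_]; [rewrite du | rewrite mulr0 eqxx].
move=> Hf; have [r [_ sr ef]] := mon_expansion rees_cf_lin rees_cf_mon rees_mon_span f.
have /choice [h Hh] (i : 'I_(size r)) : exists h : 'I_d -> 'I_N,
    mon (nth 0%MM r i) = \prod_j rees_letter (h j).
  by apply: word_mon_prod; apply: Hf; case: (sr _ (mem_nth 0%MM (ltn_ord i))).
exists (size r), (fun i => rees_cf f (nth 0%MM r i)), (fun i j => rees_letter (h i j)); split.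
  by move=> i j; apply/rees_generatorP; exists (h i j).
rewrite {1}ef (big_nth 0%MM) big_mkord; apply: eq_bigr => i _.
by rewrite Hh.
Qed.

Theorem rees_Koszul : Koszul (@rees_gr K n I1 I2).
Proof.
have good_sym i j : least_pair q t om i j = least_pair q t om j i.
  by apply: eq_forallb => i'; apply: eq_forallb => j'; rewrite addmC [(t i + _)%MM]addmC [(om i + _)%N]addnC.
split.
  exact: (word_standard_graded rees_cf_lin rees_cf_mon rees_mon_span rees_mon_nf rees_grE).
exact: (word_residue_linear good_sym rees_cf_lin rees_cf_mon rees_mon_span rees_mon_nf rees_grE).
Qed.

End ReesKoszul.
Local Close Scope ring_scope.

Theorem corollary6p21 (K : fieldType) (n : nat) (I1 I2 : ideal {mpoly K[n]})
    (G1 G2 : seq 'X_{1..n})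
    (hI1 : strongly_stable I1) (hI2 : strongly_stable I2)
    (hG1 : borel_generators G1 I1) (hG2 : borel_generators G2 I2)
    (sG1 : size G1 = 2) (sG2 : size G2 = 2)
    (dG1 : forall m, m \in G1 -> mdeg m = 2)
    (dG2 : forall m, m \in G2 -> mdeg m = 2) :
  Koszul (@rees_gr K n I1 I2) /\
  (forall a1 a2 : nat,
     has_linear_resolution (@poly_gr K n)
       (@ideal_gr K n (ideal_mul (ideal_exp I1 a1) (ideal_exp I2 a2)))).
Proof.
have [_ B1 _] := hG1; have [_ B2 _] := hG2.
have [a [b [c [d [/andP [ac cd] /andP [db bn] gen1 reg1]]]]] := borel_two_generators B1 sG1 dG1.
have [a' [b' [c' [d' [/andP [ac' cd'] /andP [db' bn'] gen2 reg2]]]]] :=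
  borel_two_generators B2 sG2 dG2.
have mon1 := monomial_ideal_mset (proj1 hI1); have mon2 := monomial_ideal_mset (proj1 hI2).
pose M (s : bool) (p : 'X_{1..n}) : Prop := 'X_[p] \in (if s then I2 else I1).
have M_ideal s : ideal_of_mset (if s then I2 else I1) (M s) by case: s.
have M_gen s : mset_gen (M s) 2 by case: s.
split; last first.
  move=> a1 a2; apply: (mset_linear_resolution (d := (a1 * 2 + a2 * 2)%N)
    (ideal_of_mset_mul (ideal_of_mset_exp a1 mon1) (ideal_of_mset_exp a2 mon2))).
    by apply: mset_borel_add; apply: mset_borel_exp => p i j pI pi ji;
       [apply: (proj2 hI1) | apply: (proj2 hI2)].
  by apply: mset_gen_add; apply: mset_gen_exp.
pose pick (x x' : nat) (s : bool) := if s then x' else x.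
have regions s : [/\ (pick a a' s <= pick c c' s)%N, (pick c c' s <= pick d d' s)%N,
    (pick d d' s <= pick b b' s)%N & (pick b b' s < n)%N] by case: s.
have M_region s (k l : 'I_n) : (k <= l)%N ->
    M s (U_(k) + U_(l))%MM <->
    staircase (pick a a' s) (pick b b' s) (pick c c' s) (pick d d' s) k l.
  by case: s; [apply: reg2 | apply: reg1].
(* If c <= d' fails then d' < c, whence c' <= d' < c <= d. *)
have [t0 cross] : exists t0, (pick c c' (~~ t0) <= pick d d' t0)%N.
  by case: (leqP c d') => [|lt]; [exists true | exists false; rewrite /pick /=; lia].
exact: (rees_Koszul M_ideal M_gen (letter_cases (t0 := t0) (M := M) regions M_region)
  (letter_var regions cross) (letter_gen (M := M) regions cross M_region)
  (least_word_unique regions cross)).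
Qed.
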